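(* Let $(R,\mathfrak m)$ be a Buchsbaum local ring of dimension $d$ and prime characteristic $p>0$, and let $I$ be an ideal of $R$ generated by a system of parameters. Then for all $i=1,\ldots,d$, \[ \lim_{q\to\infty}\frac{e_i(I^{[q]})}{q^d}=0, \] where $q=p^e$ and $e\to\infty$, and for all integers $k\ge 1$, \[ e_{HK}(I^k)=e_0(I)\binom{k+d-1}{d}. \]
   Context: Let $(R,\mathfrak m)$ be a Noetherian local ring of dimension $d$ and prime characteristic $p>0$, let $I$ be an $\mathfrak m$-primary ideal, and let $\ell$ denote length of $R$-modules. For $q=p^e$, the $q$-th Frobenius power of $I$ is $I^{[q]}=(x^q\mid x\in I)$; it satisfies $(I^k)^{[q]}=(I^{[q]})^k$. The Hilbert-Kunz multiplicity is the limit (which exists) $e_{HK}(I)=\lim_{q\to\infty}\ell(R/I^{[q]})/q^d$, with $q=p^e$. For large $n$ the length $\ell(R/I^n)$ agrees with a polynomial $P_I(n)$ of degree $d$, written \[ P_I(x)=e_0(I)\binom{x+d-1}{d}-e_1(I)\binom{x+d-2}{d-1}+\cdots+(-1)^d e_d(I), \] where the integers $e_i(I)$, $0\le i\le d$, are the Hilbert-Samuel coefficients of $I$. A Noetherian local ring $R$ is Buchsbaum if for every parameter ideal $Q$ (ideal generated by a system of parameters) the difference $\ell(R/Q)-e_0(Q)$ is independent of $Q$. *)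

(* Defs.v *)
From HB Require Import structures.
From mathcomp Require Import all_boot all_order all_algebra.
From mathcomp Require Import all_classical all_reals all_analysis.

Set Implicit Arguments.
Unset Strict Implicit.
Unset Printing Implicit Defensive.

Import Order.TTheory GRing.Theory Num.Theory.
Import numFieldNormedType.Exports.

Local Open Scope classical_set_scope.
Local Open Scope ring_scope.

(* The library has quotients of Z-modules only, and a [submodClosed] predicate
   does not coerce to a [zmodClosed] one. *)
Section QuotientModule.
Local Open Scope quotient_scope.
Variables (R : nzRingType) (M : lmodType R) (N : submodClosed M).

Definition submod_pred : {pred M} := N.

HB.instance Definition _ := GRing.isZmodClosed.Build M submod_pred
  (GRing.submod_closedB (submodClosedP N)).

Local Notation Q := (Quotient.quot submod_pred).

Definition quot_scale (a : R) (x : Q) : Q := \pi_Q (a *: repr x).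

Lemma pi_scale a (x : M) : \pi_Q (a *: x) = quot_scale a (\pi_Q x).
Proof.
apply/eqP; rewrite -[_ == _]Quotient.idealrBE -scalerBr.
have xN : x - repr (\pi_Q x) \in submod_pred.
  by rewrite Quotient.idealrBE reprK.
exact: (rpredZ a (xN : _ \in N)).
Qed.

Lemma quot_scaleA a b x : quot_scale a (quot_scale b x) = quot_scale (a * b) x.
Proof. by rewrite -[x]reprK -!pi_scale ?reprK scalerA. Qed.

Lemma quot_scale1 : left_id 1 quot_scale.
Proof. by move=> x; rewrite -[x]reprK -pi_scale scale1r. Qed.

Lemma pi_quotD (x y : M) : \pi_Q (x + y) = \pi_Q x + \pi_Q y.
Proof. exact: Quotient.pi_add. Qed.

Lemma quot_scaleDr : right_distributive quot_scale +%R.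
Proof.
move=> a x y; rewrite -[x]reprK -[y]reprK -pi_quotD -!pi_scale scalerDr.
exact: pi_quotD.
Qed.

Lemma quot_scaleDl x : {morph quot_scale^~ x : a b / a + b}.
Proof. by move=> a b; rewrite -[x]reprK -!pi_scale scalerDl pi_quotD. Qed.

HB.instance Definition _ := GRing.Zmodule_isLmodule.Build R Q
  quot_scaleA quot_scale1 quot_scaleDr quot_scaleDl.

Definition quot_module : lmodType R := Q.

End QuotientModule.

Section Length.

Definition strict_chain (T : Type) (c : nat -> {pred T}) (n : nat) : Prop :=
  forall i, (i < n)%N ->
    {subset c i <= c i.+1} /\ ~ {subset c i.+1 <= c i}.

(* The real field [K] only serves to host the values, in [\bar K]. *)
Variable K : realType.

Definition mod_length (R : nzRingType) (M : lmodType R) : \bar K :=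
  ereal_sup [set (n%:R)%:E | n in
    [set n : nat | exists c : nat -> submodClosed M, strict_chain c n]].

Definition krull_dim (R : comNzRingType) : \bar K :=
  ereal_sup [set (n%:R)%:E | n in
    [set n : nat | exists c : nat -> prime_idealr R, strict_chain c n]].

End Length.

Section Ideals.
Variable R : comNzRingType.

(* Ideals are the submodules of the regular module; unlike [idealr R], this
   includes the unit ideal. *)
Definition ideal := submodClosed R^o.

Definition ideal_gen_pred (S : set R) : {pred R^o} :=
  fun x => `[< forall J : ideal, (forall y, S y -> y \in J) -> x \in J >].

Lemma ideal_gen_submod_closed (S : set R) : submod_closed (ideal_gen_pred S).
Proof.
split; first by apply/asboolP => J _; exact: rpred0.
move=> a x y /asboolP Sx /asboolP Sy; apply/asboolP => J SJ.
by rewrite rpredD ?rpredZ ?Sx ?Sy.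
Qed.

HB.instance Definition _ (S : set R) := GRing.isSubmodClosed.Build R R^o
  (ideal_gen_pred S) (ideal_gen_submod_closed S).

Definition ideal_gen (S : set R) : ideal := ideal_gen_pred S.

Definition unit_ideal : ideal := ideal_gen setT.

Definition ideal_mul (I J : ideal) : ideal :=
  ideal_gen [set x * y | x in [set x | x \in I] & y in [set y | y \in J]].

Definition ideal_pow (I : ideal) (k : nat) : ideal :=
  iter k (ideal_mul I) unit_ideal.

Definition frobenius_pow (q : nat) (I : ideal) : ideal :=
  ideal_gen [set x ^+ q | x in [set x | x \in I]].

Definition noetherian : Prop :=
  forall I : ideal, exists s : seq R, I =i ideal_gen [set x | x \in s].

Definition maximal_ideal (m : ideal) : Prop :=
  1 \notin m /\
  forall J : ideal, {subset m <= J} -> 1 \notin J -> {subset J <= m}.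

Definition local_ring (m : ideal) : Prop :=
  maximal_ideal m /\ forall m' : ideal, maximal_ideal m' -> m' =i m.

Definition primary_ideal (I : ideal) : Prop :=
  1 \notin I /\
  forall x y : R, x * y \in I -> x \in I \/ exists n, y ^+ n \in I.

Definition m_primary (m I : ideal) : Prop :=
  primary_ideal I /\ forall x : R, x \in m <-> exists n, x ^+ n \in I.

Definition system_of_parameters (m : ideal) (d : nat) (x : d.-tuple R) : Prop :=
  m_primary m (ideal_gen [set y | y \in x]).

End Ideals.

Section Multiplicities.
Variables (K : realType) (R : comNzRingType) (d : nat).
Implicit Types I Q m : ideal R.

Definition colength I : \bar K := mod_length K (quot_module I).

(* For n > 0 the truncated subtraction n + d - i - 1 is exact, as i <= d. *)
Definition hilbert_samuel_value (e : {ffun 'I_d.+1 -> int}) (n : nat) : int :=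
  \sum_(i < d.+1) (-1) ^+ i * e i * ('C(n + d - i - 1, d - i))%:Z.

Definition is_hilbert_samuel_coeffs I (e : {ffun 'I_d.+1 -> int}) : Prop :=
  \forall n \near \oo,
    colength (ideal_pow I n) = ((hilbert_samuel_value e n)%:~R)%:E.

(* The values of a polynomial at large integers determine its coefficients in
   the binomial basis, so at most one [e] qualifies; one exists when R is
   Noetherian local of dimension d and I is primary to the maximal ideal. *)
Definition hilbert_samuel_coeff I : {ffun 'I_d.+1 -> int} :=
  xget [ffun=> 0] [set e | is_hilbert_samuel_coeffs I e].

(* By a theorem of Monsky the sequence converges when R is Noetherian local of
   characteristic p and dimension d and I is primary to the maximal ideal. *)
Definition hilbert_kunz (p : nat) I : \bar K :=
  limn (fun e : nat =>
    colength (frobenius_pow (p ^ e)%N I) * (((p ^ e)%N%:R ^+ d)^-1)%:E)%E.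

(* The defining condition only; that R is Noetherian local with maximal ideal
   m and dimension d is required separately. *)
Definition buchsbaum m : Prop :=
  exists c : \bar K, forall x : d.-tuple R, system_of_parameters m x ->
    let Q := ideal_gen [set y | y \in x] in
    (colength Q - ((hilbert_samuel_coeff Q ord0)%:~R)%:E)%E = c.

End Multiplicities.

(* Main.v *)
Require Import Defs.
From HB Require Import structures.
From mathcomp Require Import all_boot all_order all_algebra.
From mathcomp Require Import all_classical all_reals all_analysis.
From mathcomp Require Import zify ring.
Import Order.TTheory GRing.Theory Num.Theory.
Import numFieldNormedType.Exports.
Local Open Scope classical_set_scope.
Local Open Scope ring_scope.

(** Write Q for the ideal (x_1^q, ..., x_d^q), which is the q-th Frobenius power
    of I because taking q-th powers is additive; likewise the Frobenius power
    of I^k is Q^k.  Both claims follow from three facts about Q, in which c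
    denotes the constant value of the length of R/Q minus e_0(Q).

    1. e_0(Q) = q^d e_0(I) ([e0_expmap]), by comparing the powers of Q with
    those of I.

    2. The length of R/Q^n is given by the Hilbert polynomial for all n > 0,
    not just for large n ([sop_hilbert]).

    3. |e_i(Q)| <= c for 0 < i <= d ([hcoef_bound]).

    The first claim is 3 divided by q^d.  For the second, divide the Hilbert
    polynomial of Q at k by q^d: its leading term contributes
    e_0(I) C(k+d-1, d) and the others tend to 0.

    Facts 2 and 3 hold for every parameter ideal, because every system of
    parameters is a d-sequence ([buchsbaum_dseq]).  To see this, let y, a_2,
    ..., a_d be parameters and a = (a_2, ..., a_d).  Combining the constancy
    of c with fact 1 shows that e_0(y^n, a) = n e_0(y, a) ([e0_linear]), so
    that the length of R/(y^n, a) is an affine function of n; this forces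
    (a : y^n) = (a : y) ([colon_sat]), with the help of the Krull intersection
    theorem.  In characteristic p one then has (a : y) = (a : y^q) =
    (a : (y+z)^q) = (a : y+z) whenever z^q lies in a, and the d-sequence
    property follows by letting the exponents of the parameters in a grow.
    For a d-sequence, multiplication by x_i on R modulo (x_1, ..., x_(i-1))
    and the powers of Q yields a recursion that computes all the lengths
    ([gcolen_rec]), in terms of the lengths of
    ((x_1, ..., x_(i-1)) : x_i) / (x_1, ..., x_(i-1)), each at most c.

    The Hilbert polynomial of a parameter ideal has to be known to exist
    before any of this ([hilbert_function_evpoly]).  The quotients Q^n/Q^(n+1)
    are filtered by monomials; each monomial contributes the length of a
    cyclic module, and this contribution decreases when the exponents grow, so
    that by Dickson's lemma the sum over all monomials of degree n is
    eventually polynomial in n.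

    Every module that occurs is a quotient J/I of ideals of R, so lengths are
    developed only for intervals in the lattice of ideals. *)

Set Implicit Arguments.
Unset Strict Implicit.
Unset Printing Implicit Defensive.

(** * The lattice of ideals *)

Definition ideal_le (R : comNzRingType) (I J : ideal R) : Prop :=
  forall x : R, x \in I -> x \in J.
Notation "I <:= J" := (ideal_le I J) (at level 70, no associativity).

Section IdealAlgebra.
Variable R : comNzRingType.
Implicit Types (I J A B C : ideal R) (x y z r : R) (s : seq R).

Lemma ideal0 I : (0 : R) \in I. Proof. exact: rpred0. Qed.
Lemma idealD I x y : x \in I -> y \in I -> x + y \in I.
Proof. exact: rpredD. Qed.
Lemma idealB I x y : x \in I -> y \in I -> x - y \in I.
Proof.
move=> xI yI; apply: (@idealD I x (- y)) => //.
rewrite -mulN1r; exact: (rpredZ (-1 : R) (yI : (y : R^o) \in I)).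
Qed.
Lemma idealMl I r x : x \in I -> r * x \in I.
Proof. by move=> xI; exact: (rpredZ r (xI : (x : R^o) \in I)). Qed.
Lemma idealMr I r x : x \in I -> x * r \in I.
Proof. by rewrite mulrC; exact: idealMl. Qed.

(** Ideals are predicates bundled with proofs; by extensionality and proof
    irrelevance those with the same elements can be rewritten into each other. *)
Lemma ideal_ext I J : I <:= J -> J <:= I -> I = J.
Proof.
move=> IJ JI.
have : (I : {pred R^o}) = J.
  by apply/funext => x; apply/idP/idP => h; [exact: IJ | exact: JI].
case: I J {IJ JI} => [p [[a] [b]]] [q [[a'] [b']]] /= e.
move: a b a' b'; rewrite e => a b a' b'.
by rewrite (Prop_irrelevance a a') (Prop_irrelevance b b').
Qed.

Lemma ideal_le_refl I : I <:= I. Proof. by []. Qed.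
Lemma ideal_le_trans J I A : I <:= J -> J <:= A -> I <:= A.
Proof. by move=> IJ JA x /IJ/JA. Qed.

(** * Ideals given by a closed condition *)

Definition ideal_cond (P : set R) : Prop :=
  [/\ P 0, forall x y, P x -> P y -> P (x + y) & forall r x, P x -> P (r * x)].

Lemma mem_gen (P : set R) x : P x -> x \in ideal_gen P.
Proof. by move=> Px; apply/asboolP => J; exact. Qed.

Lemma gen_le (P : set R) J : (forall x, P x -> x \in J) -> ideal_gen P <:= J.
Proof. by move=> PJ x /asboolP; exact. Qed.

Lemma gen_ind (P Q : set R) : ideal_cond Q -> (forall x, P x -> Q x) ->
  forall x, x \in ideal_gen P -> Q x.
Proof.
case=> Q0 QD QM PQ x /asboolP h.
have cl : submod_closed ((fun x => `[< Q x >]) : {pred R^o}).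
  split; first exact/asboolP.
  move=> a u v /asboolP Qu /asboolP Qv; apply/asboolP; apply: QD => //.
  exact: QM.
pose J : ideal R := HB.pack ((fun x => `[< Q x >]) : {pred R^o})
  (GRing.isSubmodClosed.Build R R^o _ cl).
by apply/asboolP; apply: (h J) => y Py; apply/asboolP; exact: PQ.
Qed.

Lemma mem_gen_cond (P : set R) x : ideal_cond P -> x \in ideal_gen P <-> P x.
Proof. by move=> cP; split; [exact: (gen_ind cP) | exact: mem_gen]. Qed.

Definition topI : ideal R := unit_ideal R.
Definition botI : ideal R := ideal_gen set0.
(* The generating sets below are already closed under the ideal operations;
   [ideal_gen] only supplies the bundled structure. *)
Definition idadd I J : ideal R :=
  ideal_gen [set x : R| exists2 a : R, a \in I & x - a \in J].
Definition idcap I J : ideal R := ideal_gen [set x : R | x \in I /\ x \in J].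
Definition colon I y : ideal R := ideal_gen [set r : R | r * y \in I].
Definition scale y I : ideal R := ideal_gen [set y * r | r in [set r : R | r \in I]].
Definition gen s : ideal R := ideal_gen [set y : R | y \in s].

Lemma mem_topI x : x \in topI. Proof. exact: mem_gen. Qed.
Lemma le_topI I : I <:= topI. Proof. by move=> x _; exact: mem_topI. Qed.
Lemma eq_topI I : 1 \in I -> I = topI.
Proof.
move=> I1; apply: ideal_ext; first exact: le_topI.
by move=> x _; rewrite -[x]mulr1; exact: idealMl.
Qed.
Lemma mem_botI x : x \in botI <-> x = 0.
Proof.
split=> [|->]; last exact: ideal0.
apply: (@gen_ind _ (fun z => z = 0)) => //.
by split=> // [u v -> ->|r u ->]; rewrite ?addr0 ?mulr0.
Qed.
Lemma botI_le I : botI <:= I. Proof. by move=> x /mem_botI ->; exact: ideal0. Qed.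

Lemma mem_add I J x : x \in idadd I J <-> exists2 a : R, a \in I & x - a \in J.
Proof.
apply: mem_gen_cond; split=> /= [|u v [a aI aJ] [b bI bJ]|r u [a aI aJ]].
- by exists 0; rewrite ?subrr; exact: ideal0.
- exists (a + b); first exact: idealD.
  have -> : u + v - (a + b) = (u - a) + (v - b) by ring.
  by exact: idealD.
- by exists (r * a); rewrite -?mulrBr; exact: idealMl.
Qed.

Lemma mem_cap I J x : x \in idcap I J <-> x \in I /\ x \in J.
Proof.
apply: mem_gen_cond; split=> /= [|u v [? ?] [? ?]|r u [? ?]].
- by split; exact: ideal0.
- by split; exact: idealD.
- by split; exact: idealMl.
Qed.

Lemma mem_colon I y r : r \in colon I y <-> r * y \in I.
Proof.
apply: mem_gen_cond; split=> /= [|u v ? ?|a u ?].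
- by rewrite mul0r; exact: ideal0.
- by rewrite mulrDl; exact: idealD.
- by rewrite -mulrA; exact: idealMl.
Qed.

Lemma mem_scale y I x : x \in scale y I <-> exists2 r : R, r \in I & x = y * r.
Proof.
rewrite mem_gen_cond; first by split=> -[r rI rx]; exists r.
split=> /= [|u v [a aI <-] [b bI <-]|r u [a aI <-]].
- by exists 0; [exact: ideal0|rewrite mulr0].
- by exists (a + b); [exact: idealD|rewrite mulrDr].
- by exists (r * a); [exact: idealMl|ring].
Qed.

Lemma mem_scaleM y I r : r \in I -> y * r \in scale y I.
Proof. by move=> rI; apply/mem_scale; exists r. Qed.

Lemma idaddl I J : I <:= idadd I J.
Proof. by move=> x xI; apply/mem_add; exists x; rewrite ?subrr ?ideal0. Qed.
Lemma idaddr I J : J <:= idadd I J.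
Proof. by move=> x xI; apply/mem_add; exists 0; rewrite ?subr0 ?ideal0. Qed.
Lemma idadd_le I J A : I <:= A -> J <:= A -> idadd I J <:= A.
Proof.
move=> IA JA x /mem_add[a /IA aA /JA xaA].
by rewrite -(subrK a x); exact: idealD.
Qed.
Lemma idadd_mem I J x y : x \in I -> y \in J -> x + y \in idadd I J.
Proof. by move=> /idaddl xI /idaddr yJ; exact: idealD. Qed.
Lemma idadd_mono I J I' J' : I <:= I' -> J <:= J' -> idadd I J <:= idadd I' J'.
Proof. by move=> h h'; apply: idadd_le => x; [move/h/idaddl|move/h'/idaddr]. Qed.
Lemma idaddC I J : idadd I J = idadd J I.
Proof.
by apply: ideal_ext; apply: idadd_le; do ?[exact: idaddr|exact: idaddl].
Qed.
Lemma idaddA I J A : idadd I (idadd J A) = idadd (idadd I J) A.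
Proof.
apply: ideal_ext; repeat apply: idadd_le.
- exact: ideal_le_trans (@idaddl _ _) (@idaddl _ _).
- exact: ideal_le_trans (@idaddr _ _) (@idaddl _ _).
- exact: idaddr.
- exact: idaddl.
- exact: ideal_le_trans (@idaddl _ _) (@idaddr _ _).
- exact: ideal_le_trans (@idaddr _ _) (@idaddr _ _).
Qed.
Lemma idadd_absorb I J : J <:= I -> idadd I J = I.
Proof. by move=> JI; apply: ideal_ext; [exact: idadd_le|exact: idaddl]. Qed.
Lemma idadd0 I : idadd I botI = I. Proof. by apply: idadd_absorb; exact: botI_le. Qed.

Lemma capl I J : idcap I J <:= I. Proof. by move=> x /mem_cap[]. Qed.
Lemma capr I J : idcap I J <:= J. Proof. by move=> x /mem_cap[]. Qed.

Lemma colon_ge I y : I <:= colon I y.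
Proof. by move=> x xI; apply/mem_colon; exact: idealMr. Qed.
Lemma colon_mono I J y : I <:= J -> colon I y <:= colon J y.
Proof. by move=> IJ x /mem_colon/IJ/mem_colon. Qed.
Lemma colonM I y z : colon I (y * z) = colon (colon I y) z.
Proof.
by apply: ideal_ext => x; rewrite !mem_colon mulrA mulrAC.
Qed.

Lemma scale_mono y I J : I <:= J -> scale y I <:= scale y J.
Proof. by move=> IJ x /mem_scale[r /IJ rJ ->]; exact: mem_scaleM. Qed.

(** * Products and powers *)

Lemma mem_mul I J x y : x \in I -> y \in J -> x * y \in ideal_mul I J.
Proof. by move=> xI yJ; apply: mem_gen; exists x => //; exists y. Qed.

Lemma mul_le I J A : (forall x y, x \in I -> y \in J -> x * y \in A) ->
  ideal_mul I J <:= A.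
Proof. by move=> h; apply: gen_le => _ [x xI [y yJ <-]]; exact: h. Qed.

Lemma mul_lel I J : ideal_mul I J <:= I.
Proof. by apply: mul_le => x y xI _; exact: idealMr. Qed.
Lemma mul_ler I J : ideal_mul I J <:= J.
Proof. by apply: mul_le => x y _ yI; exact: idealMl. Qed.
Lemma mul_mono I J I' J' : I <:= I' -> J <:= J' ->
  ideal_mul I J <:= ideal_mul I' J'.
Proof. by move=> h h'; apply: mul_le => x y /h xI /h' yJ; exact: mem_mul. Qed.
End IdealAlgebra.

Section GeneratorsAndPowers.
Variable R : comNzRingType.
Implicit Types (I J A B C : ideal R) (x y z r : R) (s t : seq R).

Lemma mem_genS s y : y \in s -> y \in gen s.
Proof. by move=> ys; apply: (@mem_gen _ [set y : R | y \in s]). Qed.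

Lemma gen_seq_le s I : (forall y, y \in s -> y \in I) -> gen s <:= I.
Proof. exact: gen_le. Qed.

Lemma gen_mono s t : {subset s <= t} -> gen s <:= gen t.
Proof. by move=> st; apply: gen_seq_le => y /st; exact: mem_genS. Qed.

Lemma gen_eq s t : s =i t -> gen s = gen t.
Proof. by move=> st; apply: ideal_ext; apply: gen_mono => y; rewrite st. Qed.

Lemma gen_nil : gen [::] = botI R.
Proof. by apply: ideal_ext; [exact: gen_seq_le | exact: botI_le]. Qed.

Lemma gen_cat s t : gen (s ++ t) = idadd (gen s) (gen t).
Proof.
apply: ideal_ext.
  apply: gen_seq_le => y; rewrite mem_cat => /orP[] /mem_genS; first exact: idaddl.
  exact: idaddr.
by apply: idadd_le; apply: gen_mono => y; rewrite mem_cat => ->; rewrite ?orbT.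
Qed.

Lemma gen1 x : gen [:: x] = scale x (topI R).
Proof.
apply: ideal_ext.
  apply: gen_seq_le => y; rewrite inE => /eqP ->.
  by apply/mem_scale; exists 1; rewrite ?mulr1 ?mem_topI.
by move=> _ /mem_scale[r _ ->]; apply: idealMr; apply: mem_genS; rewrite inE.
Qed.

Lemma mem_gen1 x z : z \in gen [:: x] <-> exists r, z = r * x.
Proof.
rewrite gen1 mem_scale; split=> [[r _ ->]|[r ->]].
  by exists r; rewrite mulrC.
by exists r; [exact: mem_topI|rewrite mulrC].
Qed.

Lemma gen_cons x s : gen (x :: s) = idadd (scale x (topI R)) (gen s).
Proof. by rewrite -cat1s gen_cat gen1. Qed.

Lemma mem_gen_cons x s z :
  z \in gen (x :: s) <-> exists r, z - r * x \in gen s.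
Proof.
rewrite gen_cons mem_add; split=> [[a /mem_scale[r _ ->] h]|[r h]].
  by exists r; rewrite mulrC.
by exists (r * x) => //; apply/mem_scale; exists r; [exact: mem_topI|rewrite mulrC].
Qed.

Lemma ideal_mulDl I J A :
  ideal_mul (idadd I J) A = idadd (ideal_mul I A) (ideal_mul J A).
Proof.
apply: ideal_ext; last first.
  by apply: idadd_le; apply: mul_mono => //; [exact: idaddl|exact: idaddr].
apply: mul_le => u v /mem_add[a aI aJ] vA.
rewrite -(subrK a u) addrC mulrDl.
by apply: idadd_mem; exact: mem_mul.
Qed.

Lemma scale_mul x A : ideal_mul (scale x (topI R)) A = scale x A.
Proof.
apply: ideal_ext.
  apply: mul_le => u v /mem_scale[r _ ->] vA; rewrite -mulrA.
  by apply: mem_scaleM; exact: idealMl.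
move=> _ /mem_scale[r rA ->]; apply: mem_mul => //.
by apply/mem_scale; exists 1; rewrite ?mulr1 ?mem_topI.
Qed.

Lemma powS I n : ideal_pow I n.+1 = ideal_mul I (ideal_pow I n).
Proof. by []. Qed.

Lemma pow0 I : ideal_pow I 0 = topI R. Proof. by []. Qed.

Lemma pow1 I : ideal_pow I 1 = I.
Proof.
apply: ideal_ext; first exact: mul_lel.
by move=> x xI; rewrite -[x]mulr1; apply: mem_mul => //; exact: mem_topI.
Qed.

Lemma mem_powD I i j x y : x \in ideal_pow I i -> y \in ideal_pow I j ->
  x * y \in ideal_pow I (i + j).
Proof.
elim: i x y => [|i IH] x y xI yI; first exact: idealMl.
rewrite addSn powS; apply/mem_colon; move: x xI; apply: mul_le => a b aI bI.
by apply/mem_colon; rewrite -mulrA; apply: mem_mul => //; exact: IH.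
Qed.

Lemma mem_powX I x i : x \in I -> x ^+ i \in ideal_pow I i.
Proof.
move=> xI; elim: i => [|i IH]; first exact: mem_topI.
by rewrite exprS; exact: mem_mul.
Qed.

Lemma pow_mono I J n : I <:= J -> ideal_pow I n <:= ideal_pow J n.
Proof. by move=> IJ; elim: n => // n IH; exact: mul_mono. Qed.

Lemma pow_decr I n k : (n <= k)%N -> ideal_pow I k <:= ideal_pow I n.
Proof.
move=> /subnK <-; elim: (k - n)%N => // i IH.
by rewrite addSn => x /mul_ler; exact: IH.
Qed.

Lemma pow_le I n : (0 < n)%N -> ideal_pow I n <:= I.
Proof. by move=> n0 x /(pow_decr n0); rewrite pow1. Qed.

(** * The decomposition of a power along one generator *)

Fixpoint isum (f : nat -> ideal R) k : ideal R :=
  if k is k'.+1 then idadd (isum f k') (f k') else botI R.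

Lemma isum_ge f k i : (i < k)%N -> f i <:= isum f k.
Proof.
elim: k => // k IH; rewrite ltnS leq_eqVlt => /orP[/eqP ->|/IH h].
  exact: idaddr.
exact: ideal_le_trans h (@idaddl _ _ _).
Qed.

Lemma isum_le f k A : (forall i, (i < k)%N -> f i <:= A) -> isum f k <:= A.
Proof.
elim: k => [|k IH] h; first exact: botI_le.
by apply: idadd_le; [apply: IH => i ik; apply: h; exact: ltnW|exact: h].
Qed.

(** The part of ((x) + (s))^n whose degree in x is less than t. *)
Definition slices x s n (t : nat) : ideal R :=
  isum (fun i => scale (x ^+ i) (ideal_pow (gen s) (n - i))) t.

Lemma pow_gen_cons x s n : ideal_pow (gen (x :: s)) n = slices x s n n.+1.
Proof.
apply: ideal_ext; last first.
  apply: isum_le => i ile _ /mem_scale[r rs ->].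
  rewrite -(subnKC (ile : (i <= n)%N)); apply: mem_powD.
    by apply: mem_powX; apply: mem_genS; rewrite inE eqxx.
  by apply: pow_mono r rs; apply: gen_mono => y; rewrite inE orbC => ->.
elim: n => [|n IH].
  apply: ideal_le_trans (@idaddr _ _ _) => z _.
  by apply/mem_scale; exists z; [exact: mem_topI|rewrite expr0 mul1r].
rewrite powS; apply: mul_le => a b /mem_gen_cons[r as_] /IH.
have -> : a * b = b * a by ring.
move=> bn; apply/mem_colon; move: b bn; apply: isum_le => i ilt _ /mem_scale[w wJ ->].
apply/mem_colon.
have -> : x ^+ i * w * a =
    x ^+ i.+1 * (r * w) + x ^+ i * ((a - r * x) * w).
  by rewrite exprS; ring.
apply: idealD.
  apply: (@isum_ge _ _ i.+1); first by rewrite ltnS.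
  by apply: mem_scaleM; rewrite subSS; exact: idealMl.
apply: (@isum_ge _ _ i); first by rewrite ltnS ltnW.
by apply: mem_scaleM; rewrite subSn //; exact: mem_mul.
Qed.

End GeneratorsAndPowers.

(** * Lengths of intervals of ideals *)

Section Lengths.
Variable R : comNzRingType.
Implicit Types (I J A B C : ideal R) (x y z r : R).

(** A chain of length n from I to J, by recursion on its first step so that
    proofs go by induction on n. *)
Fixpoint chainp n I J : Prop :=
  if n is n'.+1 then exists I', [/\ I <:= I', ~ I' <:= I & chainp n' I' J]
  else I <:= J.

Lemma chainp_le n I J : chainp n I J -> I <:= J.
Proof. by elim: n I => //= n IH I [I' [II' _ /IH]]; exact: ideal_le_trans. Qed.

Lemma chainp_mono n I J I' J' : I' <:= I -> J <:= J' -> chainp n I J -> chainp n I' J'.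
Proof.
elim: n I I' => [|n IH] I I' II JJ /=.
  by move=> h; exact: ideal_le_trans II (ideal_le_trans h JJ).
move=> [C [IC CI CJ]]; exists C; split; first exact: ideal_le_trans II IC.
  by move=> CI'; apply: CI; exact: ideal_le_trans CI' II.
exact: IH CJ.
Qed.

Lemma chainp_cat a b I J C : chainp a I J -> chainp b J C -> chainp (a + b) I C.
Proof.
elim: a I => [|a IH] I /=; first by move=> IJ; exact: chainp_mono.
by move=> [D [ID DI DJ]] JC; exists D; split=> //; exact: IH.
Qed.


Lemma modular I I' J : I <:= I' ->
  idcap I' J <:= idcap I J -> idadd I' J <:= idadd I J -> I' <:= I.
Proof.
move=> II' hc ha x xI'; have /mem_add[a aI xaJ] := ha _ (@idaddl _ _ _ _ xI').
rewrite -(subrK a x); apply: idealD => //.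
suff /hc/mem_cap[] : x - a \in idcap I' J by [].
by apply/mem_cap; split=> //; apply: idealB => //; exact: II'.
Qed.

Lemma cap_mono I I' J : I <:= I' -> idcap I J <:= idcap I' J.
Proof. by move=> h x /mem_cap[/h ? ?]; apply/mem_cap. Qed.

(** Each strict step of a chain survives when intersected with J or when added
    to J, by modularity; hence lengths are at most additive. *)
Lemma chainp_split n I C J : chainp n I C -> exists k l, [/\ (n <= k + l)%N,
  chainp k (idcap I J) (idcap C J) & chainp l (idadd I J) (idadd C J)].
Proof.
elim: n I => [|n IH] I /=.
  by move=> IC; exists 0%N, 0%N; split=> //=; [exact: cap_mono|exact: idadd_mono].
move=> [D [ID DI /IH[k [l [nkl hk hl]]]]].
have [hc|hc] := pselect (idcap D J <:= idcap I J).
  have [ha|ha] := pselect (idadd D J <:= idadd I J).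
    by case: DI; exact: modular ha.
  exists k, l.+1; split; first by rewrite addnS ltnS.
    by apply: chainp_mono hk => //; exact: cap_mono.
  by exists (idadd D J); split=> //; exact: idadd_mono.
exists k.+1, l; split; first by rewrite addSn ltnS.
  by exists (idcap D J); split=> //; exact: cap_mono.
by apply: chainp_mono hl => //; exact: idadd_mono.
Qed.

Definition is_len I J n := chainp n I J /\ forall k, chainp k I J -> (k <= n)%N.
Definition fin I J := exists n, is_len I J n.
Definition len I J : nat := xget 0%N [set n | is_len I J n].

Lemma is_len_inj I J n n' : is_len I J n -> is_len I J n' -> n = n'.
Proof.
move=> [h1 h2] [h3 h4]; apply/eqP; rewrite eqn_leq h2 //= h4 //.
Qed.

Lemma len_is I J : fin I J -> is_len I J (len I J).
Proof. by move=> [n hn]; exact: (@xgetI _ 0%N [set k | is_len I J k] n hn). Qed.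

Lemma lenE I J n : is_len I J n -> len I J = n.
Proof. by move=> h; apply: (is_len_inj _ h); apply: len_is; exists n. Qed.

Lemma fin_bounded I J b : I <:= J -> (forall k, chainp k I J -> (k <= b)%N) -> fin I J.
Proof.
move=> IJ hb; have ex0 : exists k, `[< chainp k I J >] by exists 0%N; apply/asboolP.
have bd k : `[< chainp k I J >] -> (k <= b)%N by move/asboolP/hb.
by case: (ex_maxnP ex0 bd) => n /asboolP hn hm; exists n; split=> // k /asboolP/hm.
Qed.

Lemma fin_sub I J I' J' : fin I J -> I <:= I' -> I' <:= J' -> J' <:= J -> fin I' J'.
Proof.
move=> [n [_ hn]] II IJ JJ; apply: (@fin_bounded _ _ n) => // k hk.
by apply: hn; exact: chainp_mono hk.
Qed.

Lemma is_len_add I J C a b : is_len I J a -> is_len J C b -> is_len I C (a + b).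
Proof.
move=> [ca ha] [cb hb]; split; first exact: chainp_cat ca cb.
move=> n /(@chainp_split _ _ _ J)[k [l [nkl ck cl]]].
apply: leq_trans nkl _; apply: leq_add.
  apply: ha; apply: chainp_mono ck; last exact: capr.
  by move=> x xI; apply/mem_cap; split=> //; exact: (chainp_le ca).
apply: hb; apply: chainp_mono cl; first exact: idaddr.
by apply: idadd_le => //; exact: (chainp_le cb).
Qed.

Lemma len_add I J C : fin I C -> I <:= J -> J <:= C ->
  len I C = (len I J + len J C)%N.
Proof.
move=> fIC IJ JC; apply: lenE; apply: is_len_add; apply: len_is.
  exact: fin_sub fIC _ _ JC.
exact: fin_sub fIC IJ JC _.
Qed.

Lemma fin_trans I J C : fin I J -> fin J C -> fin I C.
Proof. by move=> [a ha] [b hb]; exists (a + b)%N; exact: is_len_add ha hb. Qed.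

Lemma len0_eq I J : fin I J -> I <:= J -> len I J = 0%N -> I = J.
Proof.
move=> fIJ IJ l0; apply: ideal_ext => //.
have [_] := len_is fIJ; rewrite l0 => h.
have [//|nJI] := pselect (J <:= I).
by have : (1 <= 0)%N by apply: h; exists J; split.
Qed.

Lemma len_eq0 I : len I I = 0%N.
Proof.
apply: lenE; split=> [//|[|k]] //= [D [ID DI /chainp_le DI']].
by case: DI.
Qed.

(** Only an order embedding of the interval is needed to carry chains over; the
    ends of the chain are the images of the ends of the interval. *)
Lemma transport (f : ideal R -> ideal R) n I J :
  (forall C D, I <:= C -> C <:= D -> D <:= J ->
     f C <:= f D /\ (f D <:= f C -> D <:= C)) ->
  chainp n I J -> chainp n (f I) (f J).
Proof.
elim: n I => [|n IH] I hf /=.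
  by move=> IJ; exact: (hf _ _ (@ideal_le_refl _ _) IJ (@ideal_le_refl _ _)).1.
move=> [D [ID DI DJ]]; exists (f D); have DJ' := chainp_le DJ.
split; [exact: (hf _ _ (@ideal_le_refl _ _) ID DJ').1| |].
  by move=> h; apply: DI; exact: (hf _ _ (@ideal_le_refl _ _) ID DJ').2 h.
apply: IH => // C E DC CE EJ; apply: hf => //; exact: ideal_le_trans DC.
Qed.

(** Multiplication by y induces an isomorphism from (A + (I : y)) / (I : y) to
    (I + yA) / I.  It stands in for the exact sequences of modules that usually
    serve to compute lengths. *)
Lemma chainp_colon n I y A :
  chainp n (colon I y) (idadd A (colon I y)) <-> chainp n I (idadd I (scale y A)).
Proof.
split=> h.
  have := @transport (fun C => idadd I (scale y C)) n _ _ _ h.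
  have -> : idadd I (scale y (colon I y)) = I.
    by apply: idadd_absorb => _ /mem_scale[r /mem_colon rI ->]; rewrite mulrC.
  have -> : idadd I (scale y (idadd A (colon I y))) = idadd I (scale y A).
    apply: ideal_ext; last by apply: idadd_mono => //; apply: scale_mono; exact: idaddl.
    apply: idadd_le; first exact: idaddl.
    move=> _ /mem_scale[r /mem_add[a aA /mem_colon ra] ->].
    rewrite -(subrK a r) mulrDr addrC [y * (_ - _)]mulrC addrC.
    by apply: idadd_mem => //; exact: mem_scaleM.
  apply=> C D IC CD _; split; first by apply: idadd_mono => //; exact: scale_mono.
  move=> hDC r rD; have /mem_add[a aI /mem_scale[t tC e]] : y * r \in idadd I (scale y C).
    by apply: hDC; apply: idaddr; exact: mem_scaleM.
  rewrite -(subrK t r); apply: idealD => //; apply: IC; apply/mem_colon.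
  by rewrite mulrBl -[t * y]mulrC -e mulrC opprB addrC subrK.
have := @transport (fun C => colon C y) n _ _ _ h.
have -> : colon (idadd I (scale y A)) y = idadd A (colon I y).
  apply: ideal_ext.
    move=> r /mem_colon/mem_add[a aI /mem_scale[t tA e]].
    rewrite -(subrK t r) addrC; apply: idadd_mem => //; apply/mem_colon.
    by rewrite mulrBl -[t * y]mulrC -e opprB addrC subrK.
  apply: idadd_le => r; last by move/mem_colon => h'; apply/mem_colon; exact: idaddl.
  by move=> rA; apply/mem_colon; apply: idaddr; rewrite mulrC; exact: mem_scaleM.
apply=> C D IC CD DJ; split; first exact: colon_mono.
move=> hDC x xD; have /DJ/mem_add[a aI /mem_scale[t tA e]] := xD.
rewrite -(subrK a x); apply: idealD; last exact: IC.
rewrite e mulrC; apply/mem_colon; apply: hDC; apply/mem_colon.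
by rewrite mulrC -e; apply: idealB => //; apply: CD; exact: IC.
Qed.

(** The diamond isomorphism. *)
Lemma chainp_diamond n I J : chainp n (idcap I J) J <-> chainp n I (idadd I J).
Proof.
split=> h.
  have := @transport (fun C => idadd I C) n _ _ _ h.
  have -> : idadd I (idcap I J) = I by apply: idadd_absorb; exact: capl.
  apply=> C D IC CD DJ; split; first exact: idadd_mono.
  move=> hDC; apply: (@modular C D I) => //; last by rewrite ![idadd _ I]idaddC.
  move=> x /mem_cap[xD xI]; apply/mem_cap; split=> //; apply: IC.
  by apply/mem_cap; split=> //; exact: DJ.
have := @transport (fun C => idcap C J) n _ _ _ h.
have -> : idcap (idadd I J) J = J.
  apply: ideal_ext; first exact: capr.
  by move=> x xJ; apply/mem_cap; split=> //; exact: idaddr.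
apply=> C D IC CD DJ; split; first exact: cap_mono.
move=> hDC; apply: (@modular C D J) => //.
apply: idadd_le; last exact: idaddr.
by apply: ideal_le_trans DJ _; exact: idadd_mono.
Qed.

Lemma len_colon I y A :
  len I (idadd I (scale y A)) = len (colon I y) (idadd A (colon I y)).
Proof.
by rewrite /len; congr (xget _ _); apply/funext => n; apply/propext; split;
  case=> [/chainp_colon h1 h2]; split=> // k /chainp_colon/h2.
Qed.

Lemma len_diamond I J : len (idcap I J) J = len I (idadd I J).
Proof.
by rewrite /len; congr (xget _ _); apply/funext => n; apply/propext; split;
  case=> [/chainp_diamond h1 h2]; split=> // k /chainp_diamond/h2.
Qed.

(** * Colengths *)

Definition fincolen I := fin I (topI R).
Definition colen I := len I (topI R).

Lemma fincolen_sub I J : I <:= J -> fincolen I -> fincolen J.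
Proof. by move=> IJ fI; apply: fin_sub fI IJ _ _ => //; exact: le_topI. Qed.

Lemma colen_len I J : fincolen I -> I <:= J -> colen I = (len I J + colen J)%N.
Proof. by move=> fI IJ; apply: len_add => //; exact: le_topI. Qed.

Lemma colen_mono I J : fincolen I -> I <:= J -> (colen J <= colen I)%N.
Proof. by move=> fI IJ; rewrite (colen_len fI IJ) leq_addl. Qed.

Lemma colen_eq I J : fincolen I -> I <:= J -> colen I = colen J -> I = J.
Proof.
move=> fI IJ /eqP; rewrite (colen_len fI IJ) -{2}[colen J]add0n eqn_add2r => /eqP.
by apply: len0_eq => //; apply: fin_sub fI _ _ _ => //; exact: le_topI.
Qed.

(** Additivity on 0 -> R/(I : y) -> R/I -> R/(I + yR) -> 0. *)
Lemma colen_colon I y : fincolen I ->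
  colen I = (colen (colon I y) + colen (idadd I (scale y (topI R))))%N.
Proof.
move=> fI; rewrite (colen_len fI (@idaddl _ _ (scale y (topI R)))) len_colon.
congr (len _ _ + _)%N; apply: ideal_ext; first exact: le_topI.
exact: idaddl.
Qed.

Lemma colen_top : colen (topI R) = 0%N. Proof. exact: len_eq0. Qed.

End Lengths.

(** * Colengths of ideals as lengths of quotient modules *)

Section Colength.
Local Open Scope quotient_scope.
Variables (R : comNzRingType) (I : ideal R).
Implicit Types (C D : ideal R).
Local Notation M := (quot_module I).
Local Notation Q := (Quotient.quot (submod_pred I)).

Definition proj (r : R) : M := (\pi_Q r : Q).

Lemma projD a b : proj (a + b) = proj a + proj b.
Proof. exact: pi_quotD. Qed.

Lemma projZ a b : proj (a * b) = a *: proj b.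
Proof. exact: (@pi_scale R (R : comNzRingType)^o I a b). Qed.

Lemma proj0 : proj 0 = 0.
Proof. by apply: (@addrI _ (proj 0)); rewrite -projD !addr0. Qed.

Lemma proj_repr (q : M) : proj (repr (q : Q)) = q.
Proof. exact: reprK. Qed.

(* A quotient class is tested for membership on its chosen representative. *)
Lemma repr_proj_mem C a : I <:= C -> (repr (proj a : Q) \in C) = (a \in C).
Proof.
move=> IC; have h : a - repr (proj a : Q) \in C.
  apply: IC.
  have := @Quotient.idealrBE _ (submod_pred I) a (repr (proj a : Q)).
  by rewrite /proj reprK eqxx.
apply/idP/idP => hm; first by rewrite -(subrK (repr (proj a : Q)) a); exact: idealD.
have -> : repr (proj a : Q) = a - (a - repr (proj a : Q)).
  by rewrite opprB addrC subrK.
exact: idealB.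
Qed.

Lemma image_submod_closed C : I <:= C ->
  submod_closed ((fun q : M => repr (q : Q) \in C) : {pred M}).
Proof.
move=> IC; split; first by rewrite -topredE /= -proj0 repr_proj_mem // ideal0.
move=> a u v; rewrite -!topredE /= => uC vC.
rewrite -(proj_repr u) -(proj_repr v) -projZ -projD repr_proj_mem //.
by apply: idealD => //; exact: idealMl.
Qed.

Lemma image_submod C : I <:= C ->
  exists D : submodClosed M, forall a, (proj a \in D) = (a \in C).
Proof.
move=> IC.
pose D : submodClosed M := HB.pack ((fun q : M => repr (q : Q) \in C) : {pred M})
  (GRing.isSubmodClosed.Build R M _ (image_submod_closed IC)).
by exists D => a; rewrite -repr_proj_mem.
Qed.

Lemma preimage_ideal (D : submodClosed M) :
  exists2 C, I <:= C & forall a, (a \in C) = (proj a \in D).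
Proof.
have cD : @ideal_cond R [set a | proj a \in D].
  split=> /= [|a b aD bD|r a aD]; first by rewrite proj0 rpred0.
    by rewrite projD rpredD.
  by rewrite projZ rpredZ.
have memC a : (a \in ideal_gen [set a | proj a \in D]) = (proj a \in D).
  by apply/idP/idP => /(mem_gen_cond a cD).
exists (ideal_gen [set a | proj a \in D]) => // a aI; rewrite memC.
have -> : proj a = 0.
  rewrite -proj0; apply/eqP.
  by rewrite /proj -[_ == _]Quotient.idealrBE subr0.
exact: rpred0.
Qed.

Lemma chainp_of_chain n : forall c : nat -> submodClosed M, strict_chain c n ->
  forall C, I <:= C -> (forall a, (a \in C) = (proj a \in c 0%N)) ->
  chainp n C (topI R).
Proof.
elim: n => [|n IH] c hc C IC hC /=; first exact: le_topI.
have [D ID hD] := preimage_ideal (c 1%N).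
have [c01 c10] := hc 0%N (ltn0Sn n).
exists D; split=> [a|DC|].
- by rewrite hC hD => /c01.
- by apply: c10 => q; rewrite -(proj_repr q) -hD -hC; exact: DC.
- apply: (IH (fun i => c i.+1)) => // i i_n; exact: hc.
Qed.

Lemma chain_of_chainp n : forall C, I <:= C -> chainp n C (topI R) ->
  exists2 c : nat -> submodClosed M, strict_chain c n &
    forall a, (proj a \in c 0%N) = (a \in C).
Proof.
elim: n => [|n IH] C IC /=.
  by have [D hD] := image_submod IC => _; exists (fun=> D).
move=> [C' [CC' C'C hC']]; have [D hD] := image_submod IC.
have [c hc c0] := IH C' (ideal_le_trans IC CC') hC'.
exists (fun i => if i is i'.+1 then c i' else D) => // -[_|i i_n]; last exact: hc.
split=> [q|h].
  by rewrite -(proj_repr q) hD c0; exact: CC'.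
by apply: C'C => a; rewrite -c0 -hD => /h.
Qed.

(** Submodules of R/I correspond to ideals containing I. *)
Lemma colengthE (K : realType) : fincolen I -> colength K I = ((colen I)%:R)%:E.
Proof.
move=> fI; have [hc hm] := len_is fI.
rewrite /colength /mod_length; apply/eqP; rewrite eq_le; apply/andP; split.
  apply: ub_ereal_sup => _ [n [c hcn] <-]; rewrite lee_fin ler_nat; apply: hm.
  have [C IC hC] := preimage_ideal (c 0%N).
  by apply: chainp_mono (chainp_of_chain hcn IC hC).
apply: ereal_sup_ubound; exists (colen I) => //.
by have [c hcn _] := chain_of_chainp (@ideal_le_refl _ I) hc; exists c.
Qed.

End Colength.

(** * Noetherian local rings *)

Section Noetherian.
Variables (R : comNzRingType) (hnoeth : noetherian R).
Implicit Types (I J A B C : ideal R) (x y z r : R).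

(** The generators of the union all lie in one member of the chain. *)
Lemma asc_chain_stops (f : nat -> ideal R) : (forall n, f n <:= f n.+1) ->
  exists n, f n.+1 <:= f n.
Proof.
move=> hf; have hle i j : (i <= j)%N -> f i <:= f j.
  move=> /subnK <-; elim: (j - i)%N => // k IH.
  by rewrite addSn; exact: ideal_le_trans IH (hf _).
have cU : @ideal_cond R [set x | exists n, x \in f n].
  split=> [|x y [i xi] [j yj]|r x [i xi]].
  - by exists 0%N; exact: ideal0.
  - exists (maxn i j); apply: idealD; first exact: hle (leq_maxl _ _) _ xi.
    exact: hle (leq_maxr _ _) _ yj.
  - by exists i; exact: idealMl.
have [s hs] := hnoeth (ideal_gen [set x | exists n, x \in f n]).
have hsn : exists n, forall y, y \in s -> y \in f n.
  have : forall y, y \in s -> exists n, y \in f n.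
    by move=> y ys; apply/(mem_gen_cond y cU); rewrite hs; exact: mem_genS.
  elim: s {hs} => [|y s IH] h; first by exists 0%N.
  have [n hn] := IH (fun z zs => h z (mem_behead (s := y :: s) zs)).
  have [k hk] := h y (mem_head _ _); exists (maxn n k) => z.
  rewrite inE => /orP[/eqP ->|/hn]; first exact: hle (leq_maxr _ _) _ hk.
  exact: (hle _ _ (leq_maxl _ _)).
have [n hn] := hsn; exists n => x xf.
apply: (gen_seq_le hn); rewrite /gen -hs.
by apply/(mem_gen_cond x cU); exists n.+1.
Qed.

(** Otherwise dependent choice gives an infinite strictly increasing sequence. *)
Lemma maximal_exists (P : ideal R -> Prop) I0 : P I0 ->
  exists2 I, P I & forall J, P J -> I <:= J -> J <:= I.
Proof.
move=> PI0; apply: contrapT => hno.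
have next (I : {I | P I}) : exists J : {I | P I},
    sval I <:= sval J /\ ~ sval J <:= sval I.
  apply: contrapT => hn; apply: hno; exists (sval I); first exact: (svalP I).
  move=> J PJ IJ; apply: contrapT => nJI; apply: hn.
  by exists (exist _ J PJ).
have [g hg] := choice next.
pose f n := sval (iter n g (exist _ I0 PI0)).
have [n] : exists n, f n.+1 <:= f n by apply: asc_chain_stops => n; exact: (hg _).1.
exact: (hg _).2.
Qed.

Variables (m : ideal R) (hloc : local_ring m).

(** Otherwise (u) is contained in a maximal ideal, which can only be m. *)
Lemma nonmax_unit u : u \notin m -> exists v, v * u = 1.
Proof.
move=> um; apply: contrapT => nu.
have h0 : (1 : R) \notin gen [:: u].
  by apply/negP => /mem_gen1[v e]; apply: nu; exists v.
have [M [uM M1] hM] := @maximal_exists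
  (fun J => gen [:: u] <:= J /\ (1 : R) \notin J) (gen [:: u]) (conj (@ideal_le_refl _ _) h0).
have mM : maximal_ideal M.
  split=> // J MJ J1 x; apply: hM => //; split=> //.
  by move=> z /uM/MJ.
have := hloc.2 _ mM u; rewrite (negPf um).
by move=> e; move: (uM u (mem_genS (mem_head _ _))); rewrite e.
Qed.

(** Krull intersection for a principal filtration.  Write r = b_n + s_n x^n
    with b_n in B; the ideal of all the s_n is finitely generated, so that some
    s_n is a combination of the previous ones; multiplied by x^n this says that
    (1 - t x) r is in B for some t, and 1 - t x is a unit. *)
Lemma krull_principal B x r : x \in m ->
  (forall N, r \in idadd B (gen [:: x ^+ N])) -> r \in B.
Proof.
move=> xm hr; have hs : forall N, exists t, r - t * x ^+ N \in B.
  move=> N; have /mem_add[b bB /mem_gen1[t e]] := hr N.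
  by exists t; rewrite -e opprB addrC subrK.
have [s {}hs] := choice hs.
pose f n := gen [seq s i | i <- iota 0 n].
have fS n : f n <:= f n.+1.
  by apply: gen_mono => y; rewrite -addn1 iotaD map_cat mem_cat => ->.
have [n hn] := asc_chain_stops fS.
have snf : s n \in f n.
  by apply: hn; apply: mem_genS; apply: map_f; rewrite mem_iota add0n leq0n ltnSn.
(* A relation s_n = sum of c_i s_i (i < n), multiplied by x^n. *)
have key : exists t, (s n * x ^+ n) - t * x * r \in B.
  suff h : f n <:= colon (idadd B (gen [:: x * r])) (x ^+ n).
    have /h/mem_colon/mem_add[b bB /mem_gen1[t e]] := snf.
    exists t; rewrite -mulrA -e.
    by rewrite opprB addrC subrK.
  apply: gen_seq_le => w /mapP[i]; rewrite mem_iota add0n => /andP[_ i_n] ->.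
  apply/mem_colon; have -> : s i * x ^+ n =
      (x ^+ (n - i).-1 * - x) * (r - s i * x ^+ i) + x ^+ (n - i).-1 * (x * r).
    have {1}-> : n = ((n - i).-1 + 1 + i)%N.
      by rewrite addn1 prednK ?subn_gt0 // subnK // ltnW.
    by rewrite !exprD expr1; ring.
  apply: idadd_mem; first by apply: idealMl; exact: hs.
  by apply/mem_gen1; eexists.
have [t ht] := key.
have /nonmax_unit[v ev] : 1 - t * x \notin m.
  apply/negP => h; move: hloc.1.1 => /negP; apply.
  by rewrite -(subrK (t * x) 1); apply: idealD => //; exact: idealMl.
have -> : r = v * ((r - s n * x ^+ n) + (s n * x ^+ n - t * x * r)).
  rewrite -[LHS]mul1r -ev; ring.
by apply: idealMl; apply: idealD => //; exact: hs.
Qed.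

(** The same for several elements, one at a time. *)
Lemma krull_seq (ys : seq R) B r : (forall y, y \in ys -> y \in m) ->
  (forall N, r \in idadd B (gen [seq y ^+ N | y <- ys])) -> r \in B.
Proof.
elim: ys B => [|y ys IH] B ym hr; first by have := hr 0%N; rewrite gen_nil idadd0.
apply: (@krull_principal _ y); first by apply: ym; exact: mem_head.
move=> N; apply: IH => [z zs|N'].
  by apply: ym; rewrite inE zs orbT.
have : r \in idadd B (gen [seq z ^+ (maxn N N') | z <- y :: ys]) by [].
rewrite map_cons -cat1s gen_cat idaddA.
have expr_gen a k k' : (k <= k')%N -> a ^+ k' \in gen [:: a ^+ k].
  by move=> /subnK <-; rewrite exprD; apply: idealMl; exact/mem_genS/mem_head.
apply: idadd_mono; last first.
  apply: gen_seq_le => _ /mapP[z zs ->].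
  have : z ^+ maxn N N' \in gen [:: z ^+ N'] by apply: expr_gen; exact: leq_maxr.
  by apply: gen_mono => w; rewrite inE => /eqP ->; exact: map_f.
apply: idadd_mono => //; apply: gen_seq_le => w; rewrite inE => /eqP ->.
by apply: expr_gen; exact: leq_maxl.
Qed.

(** Powers with unbounded exponents suffice; below the exponents are N + 1 or
    p^N. *)
Lemma krull_seq_cofinal (ys : seq R) (k : nat -> nat) B r :
  (forall y, y \in ys -> y \in m) -> (forall N, (N <= k N)%N) ->
  (forall N, r \in idadd B (gen [seq y ^+ (k N) | y <- ys])) -> r \in B.
Proof.
move=> ym hk hr; apply: (krull_seq ym) => N; move: (hr N).
apply: idadd_mono => //; apply: gen_seq_le => _ /mapP[y ys_ ->].
rewrite -(subnK (hk N)) exprD; apply: idealMl; apply: mem_genS.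
exact: (map_f (fun z => z ^+ N)).
Qed.

(** * Ideals with radical m *)

Definition radm J := forall x, x \in m <-> exists n, x ^+ n \in J.

Lemma radm_le J : radm J -> J <:= m.
Proof. by move=> h x xJ; apply/h; exists 1%N. Qed.

Lemma radm_proper J : radm J -> 1 \notin J.
Proof. by move=> h; apply/negP => /(radm_le h); apply/negP; exact: hloc.1.1. Qed.

Lemma radical_cond J : @ideal_cond R [set x | exists n, x ^+ n \in J].
Proof.
split=> [|x y [i xi] [j yj]|r x [i xi]].
- by exists 1%N; rewrite expr1; exact: ideal0.
- exists (i + j)%N; rewrite exprDn.
  elim/big_ind: _ => [|a b|[k kij] _ /=]; [exact: ideal0|exact: idealD|].
  rewrite -mulr_natr; apply: idealMr.
  have [ik|ki] := leqP i (i + j - k).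
    by rewrite -(subnK ik) exprD; apply: idealMr; exact: idealMl.
  have jk : (j <= k)%N by lia.
  by rewrite -(subnK jk) exprD; apply: idealMl; exact: idealMl.
- by exists i; rewrite exprMn; exact: idealMl.
Qed.

Lemma radm_gen s J : radm (gen s) -> J <:= m ->
  (forall y, y \in s -> exists n, y ^+ n \in J) -> radm J.
Proof.
move=> rs Jm hs x; split=> [/rs[n xn]|[n /Jm xn]].
  have [k hk] : exists k, (x ^+ n) ^+ k \in J.
    by apply: (gen_ind (radical_cond J) hs).
  by exists (n * k)%N; rewrite exprM.
by apply/rs; have /rs[k hk] := xn; exists (n * k)%N; rewrite exprM.
Qed.

Lemma m_primary_radm J : m_primary m J <-> radm J.
Proof.
split=> [[]//|h]; split=> //; split; first exact: radm_proper.
move=> x y xyJ; have [/h ym|/nonmax_unit[v vy]] := boolP (y \in m); first by right.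
by left; rewrite -[x]mulr1 -vy mulrCA; exact: idealMl.
Qed.

(** A maximal counterexample A would be proper; by the maximal condition again
    some (A : y), with y outside A, is prime, hence contains m, so that A + (y)
    is only one step above A, whereas its colength is finite. *)
Lemma radm_fincolen J : radm J -> fincolen J.
Proof.
move=> rJ; apply: contrapT => nJ.
have [A [JA nA] hA] := @maximal_exists (fun A => J <:= A /\ ~ fincolen A) J
  (conj (@ideal_le_refl _ _) nJ).
have A1 : (1 : R) \notin A.
  apply/negP => /eq_topI A1; apply: nA; rewrite A1; exists 0%N; split=> //= k.
  case: k => [//|k] /= [D [_ nD _]]; case: nD; exact: le_topI.
have h1 : exists2 y : R, y \notin A & colon A 1 = colon A y by exists 1.
have [C [y yA ->] hC] := @maximal_exists
  (fun C => exists2 y : R, y \notin A & C = colon A y) _ h1.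
have pr (u v : R) : u * v \in colon A y -> u \notin colon A y -> v \in colon A y.
  move=> /mem_colon uv /negP nu.
  have uy : u * y \notin A by apply/negP => /mem_colon.
  apply: (hC (colon A (u * y))) => [|r|].
  - by exists (u * y).
  - by rewrite !mem_colon mulrCA => ry; exact: idealMl.
  - by apply/mem_colon; rewrite mulrA [v * u]mulrC.
have mC : m <:= colon A y.
  move=> z /rJ[n /JA zn]; have {zn} : z ^+ n \in colon A y by apply/mem_colon; exact: idealMr.
  elim: n => [|n IH].
    by rewrite expr0 => /mem_colon; rewrite mul1r (negPf yA).
  rewrite exprS => h; have [//|nz] := boolP (z \in colon A y).
  by move: (IH (pr _ _ h nz)); rewrite (negPf nz).
have yA' : ~ idadd A (gen [:: y]) <:= A.
  by move=> h; move/negP: yA; apply; apply: h; apply: idaddr; exact/mem_genS/mem_head.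
apply: nA; apply: (@fin_trans _ _ (idadd A (gen [:: y]))); last first.
  apply: contrapT => nf; apply: yA'; apply: hA; last exact: idaddl.
  by split=> //; exact: ideal_le_trans JA (@idaddl _ _ _).
apply: (@fin_bounded _ _ _ 1); first exact: idaddl.
move=> k; rewrite gen1 => /chainp_colon/(chainp_mono mC (@le_topI _ _)).
case: k => [//|[//|k]] /= [D [mD Dm [E [DE ED /chainp_le ET]]]].
have [D1|D1] := boolP ((1 : R) \in D).
  by case: ED; rewrite (eq_topI D1); exact: le_topI.
by case: Dm; exact: hloc.1.2 mD D1.
Qed.

Lemma radm_pow J n : radm J -> (0 < n)%N -> radm (ideal_pow J n).
Proof.
move=> rJ n0 x; split=> [/rJ[k xk]|[k /(pow_le n0) xk]]; last by apply/rJ; exists k.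
by exists (k * n)%N; rewrite exprM; exact: mem_powX.
Qed.

Lemma pow_fincolen J n : radm J -> fincolen (ideal_pow J n).
Proof.
move=> rJ; apply: (fincolen_sub (J := ideal_pow J n) (I := ideal_pow J n.+1)).
  exact: pow_decr.
by apply: radm_fincolen; exact: radm_pow.
Qed.

End Noetherian.

(** * Eventually polynomial sequences *)

Section Differences.
Implicit Types (f g : nat -> int) (d n : nat) (e : int).

Definition dif f : nat -> int := fun n => f n.+1 - f n.

(** For large n the sequence is a polynomial of degree at most d, in which n^d
    has coefficient e / d!. *)
Definition evpoly d e f : Prop :=
  exists N, forall n, (N <= n)%N -> iter d dif f n = e.

Lemma iter_dif_eq d f g N : (forall n, (N <= n)%N -> f n = g n) ->
  forall n, (N <= n)%N -> iter d dif f n = iter d dif g n.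
Proof.
move=> fg; elim: d => //= d IH n Nn; rewrite /dif !IH //; exact: leqW.
Qed.

Lemma iter_dif_shift d f j n :
  iter d dif (fun k => f (k + j)%N) n = iter d dif f (n + j)%N.
Proof. by elim: d n => //= d IH n; rewrite /dif !IH. Qed.

Lemma iter_dif_add d f g n :
  iter d dif (fun k => f k + g k) n = iter d dif f n + iter d dif g n.
Proof. by elim: d n => //= d IH n; rewrite /dif !IH; ring. Qed.

Lemma iter_dif_opp d f n : iter d dif (fun k => - f k) n = - iter d dif f n.
Proof. by elim: d n => //= d IH n; rewrite /dif !IH; ring. Qed.

Lemma evpoly_eq d e f g : (exists N, forall n, (N <= n)%N -> f n = g n) ->
  evpoly d e f -> evpoly d e g.
Proof.
move=> [N fg] [M hM]; exists (maxn N M) => n; rewrite geq_max => /andP[Nn Mn].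
by rewrite -(iter_dif_eq d fg) ?hM.
Qed.

Lemma evpoly_ext d e f g : f =1 g -> evpoly d e f -> evpoly d e g.
Proof. by move=> fg; apply: evpoly_eq; exists 0%N. Qed.

Lemma evpolyD d e e' f g : evpoly d e f -> evpoly d e' g ->
  evpoly d (e + e') (fun n => f n + g n).
Proof.
move=> [N hN] [M hM]; exists (maxn N M) => n; rewrite geq_max => /andP[Nn Mn].
by rewrite iter_dif_add hN ?hM.
Qed.

Lemma evpolyN d e f : evpoly d e f -> evpoly d (- e) (fun n => - f n).
Proof. by move=> [N hN]; exists N => n Nn; rewrite iter_dif_opp hN. Qed.

Lemma evpoly0 d : evpoly d 0 (fun=> 0).
Proof.
by exists 0%N => n _; elim: d n => //= d IH n; rewrite /dif !IH subrr.
Qed.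

Lemma evpoly_sum d k (e : 'I_k -> int) (f : 'I_k -> nat -> int) :
  (forall i, evpoly d (e i) (f i)) ->
  evpoly d (\sum_i e i) (fun n => \sum_i f i n).
Proof.
elim: k e f => [|k IH] e f h.
  apply: (@evpoly_ext _ _ (fun=> 0)); first by move=> n; rewrite big_ord0.
  by rewrite big_ord0; exact: evpoly0.
apply: (@evpoly_ext _ _ (fun n => f ord0 n + \sum_i f (lift ord0 i) n)).
  by move=> n; rewrite big_ord_recl.
by rewrite big_ord_recl; apply: evpolyD => //; exact: IH.
Qed.

Lemma evpolyS d e f : evpoly d.+1 e f <-> evpoly d e (dif f).
Proof. by rewrite /evpoly; split=> -[N hN]; exists N => n /hN; rewrite iterSr. Qed.

Lemma evpoly_up d e f : evpoly d e f -> evpoly d.+1 0 f.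
Proof. by move=> [N hN]; exists N => n Nn /=; rewrite /dif !hN ?subrr // leqW. Qed.

Lemma evpoly_shift d e f j : evpoly d e f -> evpoly d e (fun n => f (n + j)%N).
Proof.
move=> [N hN]; exists N => n Nn; rewrite iter_dif_shift hN //.
exact: leq_trans Nn (leq_addr _ _).
Qed.

Lemma evpoly_shiftB d e f j : evpoly d e f -> evpoly d e (fun n => f (n - j)%N).
Proof.
move=> [N hN]; exists (N + j)%N => n Nn.
rewrite -(subnK (leq_trans (leq_addl N j) Nn)).
rewrite -(iter_dif_shift d (fun n => f (n - j)%N)).
rewrite (@iter_dif_eq d _ f 0) => // [|k _]; last by rewrite addnK.
by apply: hN; lia.
Qed.

(** A vanishing difference means that the preceding one is constant; the
    constant is not known beforehand. *)
Lemma evpoly_const d f : evpoly d.+1 0 f -> exists e, evpoly d e f.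
Proof.
move=> [N hN]; exists (iter d dif f N), N => n /subnK <-.
elim: (n - N)%N => // k IH; rewrite addSn -IH.
by apply/eqP; rewrite -subr_eq0; apply/eqP; apply: hN; exact: leq_addl.
Qed.

(** * Comparing leading differences *)

(** If the first difference is eventually at most -1 the sequence tends to
    minus infinity, so negativity descends from the d-th difference to f. *)
Lemma evpoly_neg d f N : (forall n, (N <= n)%N -> iter d dif f n <= -1) ->
  exists M, forall n, (M <= n)%N -> f n <= -1.
Proof.
elim: d f N => [|d IH] f N; first by exists N.
move=> h; have [M hM] : exists M, forall n, (M <= n)%N -> dif f n <= -1.
  by apply: (IH _ N) => n Nn; rewrite -iterSr; exact: h.
have dec k : f (M + k)%N <= f M - k%:Z.
  elim: k => [|k IHk]; first by rewrite addn0 subr0.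
  have := hM (M + k)%N (leq_addr _ _); rewrite /dif addnS; lia.
exists (M + `|f M| + 1)%N => n hn.
have := dec (n - M)%N; rewrite subnKC; lia.
Qed.

Lemma evpoly_le d e e' f g : evpoly d e f -> evpoly d e' g ->
  (exists N, forall n, (N <= n)%N -> f n <= g n) -> e <= e'.
Proof.
move=> hf hg [N hN]; rewrite leNgt; apply/negP => e'e.
have [M hM] := evpolyD hg (evpolyN hf).
have [|P hP] := @evpoly_neg d (fun n => g n + - f n) M.
  by move=> n /hM ->; lia.
have := hP (maxn N P) (leq_maxr _ _); have := hN (maxn N P) (leq_maxl _ _); lia.
Qed.


(** One difference of f(N n + j) is the sum of N differences of f, hence the
    factor N for each degree. *)
Lemma evpoly_scale d e f N j : (0 < N)%N -> evpoly d e f ->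
  evpoly d (e * (N ^ d)%:Z) (fun n => f (N * n + j)%N).
Proof.
move=> N0; elim: d e f j => [|d IH] e f j.
  move=> [M hM]; exists M => n Mn /=; rewrite mulr1; apply: hM; nia.
move=> /evpolyS hf; apply/evpolyS.
apply: (@evpoly_ext _ _ (fun n => \sum_(i < N) dif f (N * n + (j + i))%N)).
  move=> n; rewrite /dif; rewrite (_ : N * n.+1 + j = (N * n + j) + N)%N; last by lia.
  move: (N * n)%N => k; elim: (N) => [|N' IH']; first by rewrite big_ord0 addn0 subrr.
  rewrite big_ord_recr /= IH' !addnS !addnA; ring.
have -> : e * (N ^ d.+1)%:Z = \sum_(i < N) e * (N ^ d)%:Z.
  by rewrite sumr_const card_ord -mulr_natr natz expnSr PoszM mulrA.
by apply: evpoly_sum => i; exact: IH.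
Qed.

(** * The binomial basis *)

(** Hilbert polynomials with their alternating signs absorbed in a: the
    coefficients are then stable under differences. *)
Definition binom_poly d (a : nat -> int) n : int :=
  \sum_(i < d.+1) a i * ('C(n + d - i - 1, d - i))%:Z.

Lemma binom_poly0 a n : binom_poly 0 a n = a 0%N.
Proof. by rewrite /binom_poly big_ord1 subn0 bin0 mulr1. Qed.

Lemma binom_poly_recr d a n : binom_poly d.+1 a n =
  \sum_(i < d.+1) a i * ('C(n + d.+1 - i - 1, d.+1 - i))%:Z + a d.+1.
Proof. by rewrite /binom_poly big_ord_recr /= subnn bin0 mulr1. Qed.

Lemma dif_binom_poly d a n : dif (binom_poly d.+1 a) n = binom_poly d a n.+1.
Proof.
rewrite /dif !binom_poly_recr /binom_poly opprD addrACA subrr addr0 -sumrB.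
apply: eq_bigr => i _; rewrite -mulrBr; congr (_ * _).
have id := ltn_ord i.
rewrite (_ : (n.+1 + d.+1 - i - 1 = (n + (d - i)).+1)%N); last by lia.
rewrite (_ : (n + d.+1 - i - 1 = n + (d - i))%N); last by lia.
rewrite (_ : (n.+1 + d - i - 1 = n + (d - i))%N); last by lia.
rewrite (_ : (d.+1 - i = (d - i).+1)%N); last by lia.
by rewrite binS PoszD addrAC subrr add0r.
Qed.

Lemma evpoly_binom_poly d a : evpoly d (a 0%N) (binom_poly d a).
Proof.
elim: d => [|d IH]; first by exists 0%N => n _ /=; rewrite binom_poly0.
apply/evpolyS; apply: (@evpoly_ext _ _ (fun n => binom_poly d a (n + 1)%N)).
  by move=> n; rewrite dif_binom_poly addn1.
exact: evpoly_shift.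
Qed.

Lemma binom_poly_ext d a b n :
  (forall i, (i <= d)%N -> a i = b i) ->
  binom_poly d a n = binom_poly d b n.
Proof. by move=> ab; apply: eq_bigr => i _; rewrite ab // -ltnS. Qed.

(** By induction the difference of f is a combination of binomials; the same
    coefficients give f up to a constant, which goes into the last one. *)
Lemma evpoly_to_binom_poly d e f : evpoly d e f ->
  exists a, exists N, forall n, (N <= n)%N -> f n = binom_poly d a n.
Proof.
elim: d e f => [|d IH] e f.
  by move=> [N hN]; exists (fun=> e), N => n Nn; rewrite binom_poly0; exact: hN.
move=> /evpolyS /(evpoly_shiftB 1) /IH[a [N hN]].
have [|e' [M hM]] := @evpoly_const 0 (fun n => f n - binom_poly d.+1 a n).
  exists N => n Nn /=; rewrite /dif.
  have := hN n.+1 (leqW Nn); rewrite subn1 /= -dif_binom_poly /dif => h.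
  have -> : f n.+1 - binom_poly d.+1 a n.+1 - (f n - binom_poly d.+1 a n) =
     (f n.+1 - f n) - (binom_poly d.+1 a n.+1 - binom_poly d.+1 a n) by ring.
  by rewrite h subrr.
exists (fun i => if i == d.+1 then a i + e' else a i), M => n /hM /= h.
rewrite -[LHS](subrK (binom_poly d.+1 a n)) h !binom_poly_recr eqxx addrC -addrA.
congr (_ + _); apply: eq_bigr => i _; by rewrite ltn_eqF.
Qed.

Lemma binom_poly_inj d a b :
  (exists N, forall n, (N <= n)%N -> binom_poly d a n = binom_poly d b n) ->
  forall i, (i <= d)%N -> a i = b i.
Proof.
elim: d => [|d IH] [N hN] i.
  by rewrite leqn0 => /eqP ->; have := hN N (leqnn _); rewrite !binom_poly0.
have ab : forall i, (i <= d)%N -> a i = b i.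
  apply: IH; exists N.+1 => -[//|n] Nn.
  by rewrite -!dif_binom_poly /dif !hN // leqW.
rewrite leq_eqVlt => /orP[/eqP ->|]; last exact: ab.
have := hN N (leqnn _); rewrite !binom_poly_recr.
rewrite (eq_bigr (fun i : 'I_d.+1 => b i * ('C(N + d.+1 - i - 1, d.+1 - i))%:Z)).
  exact: addrI.
by move=> j _; rewrite ab // -ltnS.
Qed.

End Differences.

(** * Antitone functions of several variables *)

(** Functions on N^d in curried form, so that fixing the first argument is
    application and induction on d needs no reindexing. *)
Fixpoint fn d : Type := if d is d'.+1 then nat -> fn d' else nat.

Fixpoint fle d : fn d -> fn d -> Prop :=
  if d is d'.+1 then fun f g => forall t : nat, fle (f t) (g t)
  else fun a b => (a <= b)%N.

Fixpoint anti d : fn d -> Prop :=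
  if d is d'.+1 then fun f => (forall t : nat, anti (f t)) /\
     (forall t : nat, fle (f t.+1) (f t))
  else fun=> True.

Lemma fle_refl d (f : fn d) : fle f f.
Proof. by elim: d f => //= d IH f t. Qed.

Lemma fle_trans d (f g h : fn d) : fle f g -> fle g h -> fle f h.
Proof.
elim: d f g h => [|d IH] f g h /=; first exact: leq_trans.
by move=> fg gh t; exact: IH (fg t) (gh t).
Qed.

Lemma fle_anti d (f g : fn d) : fle f g -> fle g f -> f = g.
Proof.
elim: d f g => [|d IH] f g /=; first by move=> fg gf; apply/eqP; rewrite eqn_leq fg.
by move=> fg gf; apply/funext => t; exact: IH.
Qed.

Lemma fle_iter d (f : nat -> fn d) : (forall t, fle (f t.+1) (f t)) ->
  forall i j, (i <= j)%N -> fle (f j) (f i).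
Proof.
move=> h i j /subnK <-; elim: (j - i)%N => [|k IH]; first exact: fle_refl.
by rewrite addSn; exact: fle_trans IH.
Qed.

(** Dickson's lemma: a decreasing sequence of antitone functions is eventually
    constant.  In the inductive step the diagonal n |-> f n n settles all the
    arguments beyond some N at once; finitely many remain. *)
Lemma anti_stable d (f : nat -> fn d) : (forall t, anti (f t)) ->
  (forall t, fle (f t.+1) (f t)) -> exists T, forall t, (T <= t)%N -> f t = f T.
Proof.
elim: d f => [|d IH] f ha hd.
  have ex : exists n, `[< exists t, f t = n >] by exists (f 0%N); apply/asboolP; exists 0%N.
  case: (ex_minnP ex) => _ /asboolP[T <-] hmin; exists T => t Tt.
  apply: fle_anti; first exact: (fle_iter hd Tt).
  by apply: hmin; apply/asboolP; exists t.
have hdt t i j : (i <= j)%N -> fle (f j t) (f i t).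
  by move=> ij; exact: (fle_iter hd ij).
have hat n i j : (i <= j)%N -> fle (f n j) (f n i).
  exact: (fle_iter (ha n).2).
(* Beyond N every value lies between two diagonal ones. *)
have [N hN] : exists T, forall t, (T <= t)%N -> f t t = f T T.
  apply: (IH (fun n => f n n)) => n; first exact: (ha n).1.
  exact: fle_trans (hdt _ _ _ (leqnSn n)) (hat _ _ _ (leqnSn n)).
have big n t : (N <= n)%N -> (N <= t)%N -> f n t = f N N.
  move=> Nn Nt; apply: fle_anti.
    exact: fle_trans (hdt _ _ _ Nn) (hat _ _ _ Nt).
  rewrite -(hN (maxn n t)) ?leq_max ?Nn //.
  exact: fle_trans (hdt _ _ _ (leq_maxl n t)) (hat _ _ _ (leq_maxr n t)).
have small t : exists T, forall n, (T <= n)%N -> f n t = f T t.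
  by apply: (IH (fun n => f n t)) => n; [exact: (ha n).1|exact: hd].
have [T hT] : exists T, forall t, (t < N)%N -> forall n, (T <= n)%N -> f n t = f T t.
  elim: (N) => [|N' [T hT]]; first by exists 0%N.
  have [T' hT'] := small N'; exists (maxn T T') => t.
  rewrite ltnS leq_eqVlt => /orP[/eqP ->|tN] n; rewrite geq_max => /andP[Tn T'n].
    by rewrite hT' // (hT' (maxn T T')) // leq_maxr.
  by rewrite (hT t) // (hT t tN (maxn T T')) // leq_maxl.
exists (maxn N T) => n; rewrite geq_max => /andP[Nn Tn]; apply/funext => t.
have [tN|Nt] := ltnP t N; last by rewrite big // big // leq_maxl.
by rewrite (hT t) // (hT t tN (maxn N T)) // leq_maxr.
Qed.

(** When f sends an exponent to the length attached to that monomial, this is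
    the length of the homogeneous part of degree n. *)
Fixpoint hilb d : fn d -> nat -> int :=
  if d is d'.+1 then fun f n => \sum_(t < n.+1) hilb (f t) (n - t)
  else fun v n => if n == 0%N then v%:Z else 0.

(** From some T on the slices f t all agree.  The first T slices are shifts of
    sequences that the d-th difference kills, and the remaining ones add up to
    a partial sum of one such sequence. *)
Lemma hilb_evpoly d (f : fn d) : anti f -> evpoly d 0 (hilb f).
Proof.
elim: d f => [|d IH] f; first by move=> _; exists 1%N => -[].
move=> [ha hd]; have [T hT] := anti_stable ha hd.
apply: (@evpoly_eq _ _ (fun n => (\sum_(t < T) hilb (f t) (n - t)) +
    \sum_(j < n.+1 - T) hilb (f T) j)).
  exists T => n Tn; rewrite /= -(subnKC (leqW Tn)).
  rewrite big_split_ord /=; congr (_ + _).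
  rewrite subnKC ?(leqW Tn) // subSn // [RHS](reindex_inj rev_ord_inj) /=.
  apply: eq_bigr => j _; rewrite hT ?leq_addr //; congr hilb.
  by have := ltn_ord j; lia.
rewrite -[0]addr0; apply: evpolyD.
  have := @evpoly_sum d.+1 T (fun=> 0) (fun t n => hilb (f t) (n - t)).
  rewrite big1 //; apply=> i.
  by apply: evpoly_shiftB; apply: evpoly_up; exact: IH (ha i).
pose S k := \sum_(j < k.+1) hilb (f T) j.
apply: (@evpoly_eq _ _ (fun n => S (n - T)%N)).
  by exists T => n Tn; rewrite subSn.
apply: (@evpoly_shiftB _ _ S); apply/evpolyS.
apply: (@evpoly_ext _ _ (fun n => hilb (f T) (n + 1)%N)).
  by move=> n; rewrite /dif /S [in RHS]big_ord_recr /= addrAC subrr add0r addn1.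
by apply: evpoly_shift; exact: IH (ha T).
Qed.

(** * Existence of Hilbert polynomials *)

Section HilbertFunction.
Variable R : comNzRingType.
Implicit Types (I J : ideal R) (x y z : R) (s : seq R) (B : nat -> ideal R).

(** Let B_n be ideals with y B_n contained in B_(n+1) for all generators y, and
    consider the module with homogeneous parts ((x, s)^n + B_n) / B_n, filtered
    by the degree in x.  Multiplication by x^t identifies the t-th piece of
    this filtration with the module of the same kind for the generators s and
    the ideals [lead B x s t]. *)
Definition lead B x s t : nat -> ideal R := fun j =>
  colon (idadd (B (j + t)%N) (slices x s (j + t) t)) (x ^+ t).

(** Splitting off one generator after the other reduces each monomial to a
    cyclic module; this is its length.  The ideals whose colengths are taken
    are those of the leading coefficients in Groebner basis theory. *)
Fixpoint lam s B : fn (size s) :=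
  if s is x :: s' then fun t => lam s' (lead B x s' t) else colen (B 0%N).

Lemma lead_ge B x s t j : B (j + t)%N <:= lead B x s t j.
Proof. exact: ideal_le_trans (@idaddl _ _ _) (@colon_ge _ _ _). Qed.

Lemma lead_fincolen B x s t : (forall n, fincolen (B n)) ->
  forall n, fincolen (lead B x s t n).
Proof. by move=> hB n; apply: fincolen_sub (hB (n + t)%N); exact: lead_ge. Qed.

Lemma pow_botI n : (0 < n)%N -> ideal_pow (botI R) n = botI R.
Proof. by move=> n0; apply: ideal_ext; [exact: pow_le|exact: botI_le]. Qed.

Lemma lam_len s B n : (forall n, fincolen (B n)) ->
  (len (B n) (idadd (B n) (ideal_pow (gen s) n)))%:Z = hilb (lam s B) n.
Proof.
elim: s B n => [|x s IH] B n hB.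
  rewrite gen_nil /=; case: n => [|n]; last by rewrite pow_botI //= idadd0 len_eq0.
  rewrite eqxx pow0; congr (Posz (len _ _)); apply: ideal_ext; first exact: le_topI.
  exact: idaddr.
rewrite pow_gen_cons.
suff h k : (k <= n.+1)%N -> (len (B n) (idadd (B n) (slices x s n k)))%:Z =
    \sum_(t < k) hilb (lam s (lead B x s t)) (n - t) by exact: h.
elim: k => [|k IHk] kn; first by rewrite big_ord0 /= idadd0 len_eq0.
rewrite big_ord_recr /= -IHk 1?ltnW // -IH; last exact: lead_fincolen.
rewrite -PoszD idaddA (@len_add _ _ (idadd (B n) (slices x s n k))); first last.
- exact: idaddl.
- exact: idaddl.
- by apply: (fin_sub (hB n)); rewrite -?idaddA //; [exact: idaddl|exact: le_topI].
by rewrite len_colon /lead subnK // [idadd (colon _ _) _]idaddC.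
Qed.

Lemma slices_mul_gen x s n t y : y \in s ->
  slices x s n t <:= colon (slices x s n.+1 t) y.
Proof.
move=> ys; apply: isum_le => i it _ /mem_scale[w wJ ->]; apply/mem_colon.
apply: (@isum_ge _ _ _ i) => //; rewrite -mulrA [w * y]mulrC; apply: mem_scaleM.
have [ni|ni] := ltnP n i; last by rewrite subSn //; apply: mem_mul => //; exact: mem_genS.
by have -> : (n.+1 - i = 0)%N by [lia]; exact: mem_topI.
Qed.

Lemma slices_mul_var x s n t : slices x s n t <:= colon (slices x s n.+1 t.+1) x.
Proof.
apply: isum_le => i it _ /mem_scale[w wJ ->]; apply/mem_colon.
apply: (@isum_ge _ _ _ i.+1) => //.
by rewrite mulrAC -exprSr; apply: mem_scaleM; rewrite subSS.
Qed.

Definition mul_closed s B : Prop :=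
  forall y n, y \in s -> B n <:= colon (B n.+1) y.

Lemma lead_closed x s B t : mul_closed (x :: s) B -> mul_closed s (lead B x s t).
Proof.
move=> cB y n ys r /mem_colon h; apply/mem_colon/mem_colon.
rewrite mulrAC; apply/mem_colon; move: h; apply: idadd_le => z hz; apply/mem_colon.
  apply: idaddl; rewrite addSn; apply/mem_colon; apply: cB => //.
  by rewrite inE ys orbT.
by apply: idaddr; rewrite addSn; apply/mem_colon; exact: slices_mul_gen.
Qed.

(** Multiplying by x sends the t-th piece of the filtration onto the next one,
    which is why the lengths in [lam] decrease with the exponents. *)
Lemma lead_incr x s B t n : mul_closed (x :: s) B ->
  lead B x s t n <:= lead B x s t.+1 n.
Proof.
move=> cB r /mem_colon h; apply/mem_colon.
rewrite exprSr mulrA; apply/mem_colon; move: h; apply: idadd_le => z hz; apply/mem_colon.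
  by apply: idaddl; rewrite addnS; apply/mem_colon; apply: cB => //; exact: mem_head.
by apply: idaddr; rewrite addnS; apply/mem_colon; exact: slices_mul_var.
Qed.

Lemma lam_mono s B B' : (forall n, fincolen (B n)) -> (forall n, B n <:= B' n) ->
  fle (lam s B') (lam s B).
Proof.
elim: s B B' => [|x s IH] B B' hB BB; first exact: colen_mono.
move=> t; apply: IH => [|n]; first exact: lead_fincolen.
by apply: colon_mono; exact: idadd_mono.
Qed.

Lemma lam_anti s B : (forall n, fincolen (B n)) -> mul_closed s B -> anti (lam s B).
Proof.
elim: s B => [//|x s IH] B hB cB; split=> t.
  by apply: IH; [exact: lead_fincolen|exact: lead_closed].
apply: lam_mono => [|n]; first exact: lead_fincolen.
exact: lead_incr.
Qed.

(** The lengths of Q^n/Q^(n+1), namely the differences of the colengths of Q^n,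
    are the case B_n = Q^(n+1) of the above. *)
Lemma hilbert_function_evpoly s : (forall n, fincolen (ideal_pow (gen s) n)) ->
  exists e, evpoly (size s) e (fun n => (colen (ideal_pow (gen s) n))%:Z).
Proof.
move=> hs; apply: evpoly_const; apply/evpolyS.
pose B n := ideal_pow (gen s) n.+1.
apply: (@evpoly_ext _ _ (hilb (lam s B))); last first.
  apply: hilb_evpoly; apply: lam_anti => [n|y n ys z zB]; first exact: hs.
  by apply/mem_colon; rewrite mulrC; apply: mem_mul => //; exact: mem_genS.
move=> n; rewrite -lam_len => [|k]; last exact: hs.
have le : B n <:= ideal_pow (gen s) n by exact: pow_decr.
by rewrite /dif (colen_len (hs n.+1) le) idaddC (idadd_absorb le) PoszD addrK.
Qed.

End HilbertFunction.

(** * Hilbert functions of d-sequences *)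

Section DSequences.
Variable R : comNzRingType.
Implicit Types (I J A B : ideal R) (x y z r : R) (pre post mid s : seq R).

(** Huneke's d-sequences: (pre : x y) = (pre : y) for the element x that follows
    a prefix pre and every y from x on. *)
Definition dseq s : Prop := forall pre x post y r,
  s = pre ++ x :: post -> y \in x :: post ->
  r * x * y \in gen pre -> r * y \in gen pre.

Lemma mem_gen_rcons pre x r :
  r \in gen (rcons pre x) <-> exists t, r - t * x \in gen pre.
Proof.
rewrite (@gen_eq _ (rcons pre x) (x :: pre)); first exact: mem_gen_cons.
by move=> z; rewrite mem_rcons.
Qed.

Lemma gen_rcons pre x : gen (rcons pre x) = idadd (gen pre) (scale x (topI R)).
Proof. by rewrite -cats1 gen_cat gen1. Qed.

Variable s : seq R.
Hypothesis ds : dseq s.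
Local Notation Q := (gen s).
Local Notation "Q ^^ n" := (ideal_pow Q n) (at level 30).

(** The element r of Q is written with as few generators as possible.  If y is
    the last one needed and t its coefficient, then r y lies in (pre) because
    r x does; so t y^2 lies in the ideal of the earlier generators, hence so
    does t y, and y was not needed. *)
Lemma dseq_cap pre x post r : s = pre ++ x :: post ->
  r * x \in gen pre -> r \in Q -> r \in gen pre.
Proof.
move=> es rx.
have key mid post' : s = pre ++ mid ++ post' -> r \in gen (pre ++ mid) -> r \in gen pre.
  elim/last_ind: mid post' => [|mid y IH] post' e; first by rewrite cats0.
  rewrite -rcons_cat => /mem_gen_rcons[t ht].
  have ey : s = (pre ++ mid) ++ y :: post' by rewrite e -catA cat_rcons.
  have yin : y \in x :: post.
    have /eqP : pre ++ x :: post = pre ++ mid ++ y :: post' by rewrite -es ey catA.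
    by rewrite eqseq_cat // eqxx => /eqP ->; rewrite mem_cat mem_head orbT.
  have ry : r * y \in gen pre.
    by apply: (ds es yin); apply: idealMr.
  have ty : t * y \in gen (pre ++ mid).
    apply: (ds ey (mem_head _ _)).
    have -> : t * y * y = r * y - (r - t * y) * y by ring.
    apply: idealB; last exact: idealMr.
    by apply: gen_mono ry => z zp; rewrite mem_cat zp.
  apply: (IH (y :: post')); first by rewrite ey catA.
  by rewrite -(subrK (t * y) r); exact: idealD.
move=> rQ; apply: (key (x :: post) [::]); first by rewrite cats0.
by rewrite -es.
Qed.

Lemma mul_step A y v n : y \in Q -> v \in ideal_mul A (Q ^^ n) ->
  v * y \in ideal_mul A (Q ^^ n.+1).
Proof.
move=> yQ hv; apply/mem_colon; move: v hv; apply: mul_le => a b aA bQ.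
by apply/mem_colon; rewrite -mulrA [b * y]mulrC; apply: mem_mul => //; exact: mem_mul.
Qed.

(** Induction on n, and for fixed n from the whole of s down to shorter
    prefixes: adding the next generator x to the prefix brings in a term x v of
    (pre) with v in Q^n, and [dseq_cap] puts v in (pre). *)
Lemma dseq_cap_pow n post pre r : s = pre ++ post ->
  r \in gen pre -> r \in Q ^^ n.+1 -> r \in ideal_mul (gen pre) (Q ^^ n).
Proof.
elim: n post pre r => [|n IHn] post pre r.
  by move=> _ rp _; rewrite -[r]mulr1; apply: mem_mul => //; exact: mem_topI.
elim: post pre r => [|x post IHp] pre r e rp rQ.
  by move: e; rewrite cats0 => <-; exact: rQ.
have e' : s = rcons pre x ++ post by rewrite cat_rcons.
have : r \in ideal_mul (gen (rcons pre x)) (Q ^^ n.+1).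
  by apply: IHp => //; apply: gen_mono rp => z zp; rewrite mem_rcons inE zp orbT.
rewrite gen_rcons ideal_mulDl scale_mul idaddC => /mem_add[a /mem_scale[v vQ ea] ra].
have vx : v * x \in gen pre.
  rewrite mulrC -ea -[a](subKr r); apply: idealB => //; exact: mul_lel ra.
have xQ : x \in Q by apply: mem_genS; rewrite e mem_cat mem_head orbT.
have vpre : v \in gen pre by apply: (dseq_cap e vx); exact: (@pow_le _ _ n.+1) vQ.
rewrite -(subrK a r); apply: idealD => //; rewrite ea mulrC.
by apply: mul_step => //; exact: IHn e vpre vQ.
Qed.

Lemma dseq_colon n pre x post : s = pre ++ x :: post ->
  colon (idadd (gen pre) (Q ^^ n.+1)) x = idadd (colon (gen pre) x) (Q ^^ n).
Proof.
move=> e; have xQ : x \in Q by apply: mem_genS; rewrite e mem_cat mem_head orbT.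
have e' : s = rcons pre x ++ post by rewrite cat_rcons.
apply: ideal_ext; last first.
  apply: idadd_le => r; first by move/mem_colon => h; apply/mem_colon; exact: idaddl.
  by move=> rQ; apply/mem_colon; apply: idaddr; rewrite mulrC; exact: mem_mul.
move=> r /mem_colon/mem_add[a ap hb].
have : r * x - a \in ideal_mul (gen (rcons pre x)) (Q ^^ n).
  apply: (dseq_cap_pow e') => //; rewrite gen_rcons.
  apply: idealB; last exact: idaddl.
  by apply: idaddr; rewrite mulrC; apply: mem_scaleM; exact: mem_topI.
rewrite gen_rcons ideal_mulDl scale_mul idaddC => /mem_add[b /mem_scale[v vQ eb] hu].
rewrite -(subrK v r); apply: idadd_mem => //; apply/mem_colon.
have -> : (r - v) * x = (r * x - a - b) + a by rewrite eb; ring.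
by apply: idealD => //; exact: mul_lel hu.
Qed.

Hypothesis hfin : forall n, fincolen (Q ^^ n).

Lemma fincolenQ : fincolen Q. Proof. by have := hfin 1; rewrite pow1. Qed.

(* The Hilbert function of Q on R/(pre). *)
Definition gcolen pre n := colen (idadd (gen pre) (Q ^^ n)).

(** By [dseq_cap] this is the length of (pre : x) / (pre).  Measuring it inside
    R/Q makes its finiteness evident. *)
Definition gap pre x := len Q (idadd Q (colon (gen pre) x)).

Lemma gen_pre_le pre post : s = pre ++ post -> gen pre <:= Q.
Proof. by move=> e; apply: gen_mono => z zp; rewrite e mem_cat zp. Qed.

(** Multiplication by x maps R modulo (pre) + Q^n to R modulo (pre) + Q^(n+1)
    with cokernel R modulo (pre, x) + Q^(n+1).  By [dseq_colon] its kernel is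
    the image of (pre : x), which for n > 0 has length [gap pre x] since
    (pre : x) meets Q in (pre). *)
Lemma gcolen_rec pre x post n : s = pre ++ x :: post -> (0 < n)%N ->
  (gcolen pre n.+1 + gap pre x = gcolen (rcons pre x) n.+1 + gcolen pre n)%N.
Proof.
move=> e n0; have fpre k : fincolen (idadd (gen pre) (Q ^^ k)).
  by apply: fincolen_sub (hfin k); exact: idaddr.
rewrite /gcolen (colen_colon x (fpre n.+1)) (dseq_colon n e).
rewrite (colen_len (fpre n) (J := idadd (colon (gen pre) x) (Q ^^ n))); last first.
  by apply: idadd_mono => //; exact: colon_ge.
have -> : idadd (gen (rcons pre x)) (Q ^^ n.+1) =
    idadd (idadd (gen pre) (Q ^^ n.+1)) (scale x (topI R)).
  by rewrite gen_rcons -!idaddA [idadd (scale _ _) _]idaddC.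
suff -> : gap pre x = len (idadd (gen pre) (Q ^^ n)) (idadd (colon (gen pre) x) (Q ^^ n)).
  lia.
have nQ : Q ^^ n <:= Q by exact: pow_le.
have -> : idadd (gen pre) (Q ^^ n) = idcap Q (idadd (colon (gen pre) x) (Q ^^ n)).
  apply: ideal_ext.
    apply: idadd_le => r rp; apply/mem_cap; split.
    - exact: (gen_pre_le e).
    - by apply: idaddl; exact: colon_ge.
    - exact: nQ.
    - exact: idaddr.
  move=> r /mem_cap[rQ /mem_add[a /mem_colon ax ra]].
  rewrite -(subrK a r) addrC; apply: idadd_mem => //; apply: (dseq_cap e ax).
  by rewrite -[a](subKr r); apply: idealB => //; exact: nQ.
by rewrite len_diamond idaddC -idaddA [idadd _ Q]idaddC (idadd_absorb nQ) [LHS]/gap idaddC.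
Qed.

(** Gaps counted from the end of s, so that [ell 1] belongs to the last
    generator; with [ell 0] the colength of Q the coefficients of the Hilbert
    polynomial become the successive differences [hcoef]. *)
Definition ell k : int := if k is 0 then (colen Q)%:Z
  else (gap (take (size s - k) s) (nth 0 s (size s - k)))%:Z.

Definition hcoef D k : int := ell k - (if (k < D)%N then ell k.+1 else 0).

(* This is the value of the polynomial at 1, where all binomials are 1. *)
Lemma sum_hcoef D : \sum_(i < D.+1) hcoef D i = ell 0.
Proof.
rewrite big_ord_recr /= {2}/hcoef ltnn subr0.
suff h k : (k <= D)%N -> \sum_(i < k) hcoef D i = ell 0 - ell k by rewrite h // subrK.
elim: k => [|k IH] kD; first by rewrite big_ord0 subrr.
by rewrite big_ord_recr /= IH 1?ltnW // /hcoef kD; ring.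
Qed.

Lemma gcolen_binom_poly post pre n : s = pre ++ post -> (0 < n)%N ->
  (gcolen pre n)%:Z = binom_poly (size post) (hcoef (size post)) n.
Proof.
elim: post pre n => [|x post IH] pre n e n0.
  rewrite binom_poly0 /hcoef subr0 /gcolen; congr (Posz (colen _)).
  by move: e; rewrite cats0 => <-; apply: idadd_absorb; exact: pow_le.
have e' : s = rcons pre x ++ post by rewrite cat_rcons.
case: n n0 => // n _; elim: n => [|n IHn].
  rewrite /gcolen pow1 idaddC (idadd_absorb (gen_pre_le e)) -[LHS]/(ell 0).
  rewrite -(sum_hcoef (size post).+1) /binom_poly; apply: eq_bigr => i _ /=.
  have id := ltn_ord i.
  rewrite (_ : (1 + (size post).+1 - i - 1 = (size post).+1 - i)%N); last by lia.
  by rewrite binn mulr1.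
have -> : binom_poly (size (x :: post)) (hcoef (size (x :: post))) n.+2 =
   binom_poly (size (x :: post)) (hcoef (size (x :: post))) n.+1 +
   dif (binom_poly (size (x :: post)) (hcoef (size (x :: post)))) n.+1.
  by rewrite /dif addrC subrK.
rewrite -IHn dif_binom_poly.
have -> : binom_poly (size post) (hcoef (size (x :: post))) n.+2 =
    (gcolen (rcons pre x) n.+2)%:Z - (gap pre x)%:Z.
  rewrite (IH _ n.+2 e') //.
  have -> : (gap pre x)%:Z = ell (size post).+1.
    rewrite /ell e size_cat /= addnS subSS addnK take_size_cat // nth_cat.
    by rewrite ltnn subnn.
  rewrite /binom_poly !big_ord_recr /= subnn bin0 !mulr1 -addrA; congr (_ + _).
    apply: eq_bigr => i _; congr (_ * _); rewrite /hcoef /=.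
    by have := ltn_ord i => id; rewrite id ltnS ltnW.
  by rewrite /hcoef ltnSn ltnn subr0.
by have := gcolen_rec e (ltn0Sn n); lia.
Qed.

Theorem dseq_hilbert_function n : (0 < n)%N ->
  (colen (Q ^^ n))%:Z = binom_poly (size s) (hcoef (size s)) n.
Proof.
move=> n0; rewrite -(@gcolen_binom_poly s [::] n) // /gcolen gen_nil idaddC idadd0 //.
Qed.

Lemma ell_ge0 k : 0 <= ell k. Proof. by case: k. Qed.

(** For a d-sequence (pre : x) is contained in (pre' : z), where z is the last
    generator and pre' all the generators before it. *)
Lemma ell_le1 k : (0 < k)%N -> (k <= size s)%N -> ell k <= ell 1.
Proof.
case: k => // k _ ks.
have decomp i : (i < size s)%N -> s = take i s ++ nth 0 s i :: drop i.+1 s.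
  by move=> is_; rewrite -drop_nth // cat_take_drop.
have k0 : (size s - k.+1 < size s)%N by lia.
have l0 : (size s - 1 < size s)%N by lia.
have e := decomp _ k0; rewrite /ell.
set pre := take _ s in e *; set x := nth 0 s (size s - k.+1) in e *.
have hsub : colon (gen pre) x <:= colon (gen (take (size s - 1) s)) (nth 0 s (size s - 1)).
  move=> r /mem_colon rx; apply/mem_colon.
  have zin : nth 0 s (size s - 1) \in x :: drop (size s - k.+1).+1 s.
    rewrite -drop_nth //.
    rewrite -[in X in X \in _](subnKC (_ : size s - k.+1 <= size s - 1)%N); last by lia.
    rewrite -nth_drop; apply: mem_nth; rewrite size_drop.
    by move: (size s) ks => n0 ks; lia.
  have : r * nth 0 s (size s - 1) \in gen pre by apply: (ds e zin); exact: idealMr.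
  apply: gen_mono => z; rewrite /pre.
  have le1 : (size s - k.+1 <= size s - 1)%N by move: (size s) ks => n0 ks; lia.
  by rewrite -(take_takel s le1) => /mem_take.
rewrite lez_nat /gap (len_add (J := idadd Q (colon (gen pre) x))
  (C := idadd Q (colon (gen (take (size s - 1) s)) (nth 0 s (size s - 1))))).
- exact: leq_addr.
- by apply: fin_sub fincolenQ _ _ _ => //; [exact: idaddl|exact: le_topI].
- exact: idaddl.
- exact: idadd_mono.
Qed.

End DSequences.

(** * Parameter ideals of a Noetherian local ring *)

Section SystemsOfParameters.
Variables (K : realType) (R : comNzRingType) (m : ideal R) (d : nat).
Hypotheses (hnoeth : noetherian R) (hloc : local_ring m).
Implicit Types (I J A B : ideal R) (x y z r : R) (pre post a b s : seq R).

Definition sop s : Prop := size s = d /\ radm m (gen s).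

Lemma sop_tuple s : sop s ->
  exists2 t : d.-tuple R, system_of_parameters m t &
    [set y | y \in t] = [set y | y \in s].
Proof.
move=> [/eqP sz rs]; exists (Tuple sz) => //.
by apply/(m_primary_radm hnoeth hloc).
Qed.

Lemma sop_mem s y : sop s -> y \in s -> y \in m.
Proof. by move=> [_ rs] ys; apply: (radm_le rs); exact: mem_genS. Qed.

Lemma sop_fincolen s n : sop s -> fincolen (ideal_pow (gen s) n).
Proof. by move=> [_ rs]; exact: (pow_fincolen hnoeth hloc). Qed.

Lemma sop_fincolen1 s : sop s -> fincolen (gen s).
Proof. by move=> ss; have := sop_fincolen 1 ss; rewrite pow1. Qed.

(** Replacing parameters by elements of m that generate them up to radical. *)
Lemma sop_change s s' : sop s -> size s' = size s ->
  (forall z, z \in s' -> z \in m) ->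
  (forall w, w \in s -> exists n, w ^+ n \in gen s') -> sop s'.
Proof.
move=> [sz rs] sz' sm hw; split; first by rewrite sz'.
by apply: (radm_gen rs) => //; exact: gen_seq_le.
Qed.

Lemma sop_perm s s' : perm_eq s s' -> sop s -> sop s'.
Proof.
move=> pe ss; apply: (sop_change ss) => [|z|w ws].
- by rewrite (perm_size pe).
- by rewrite -(perm_mem pe); exact: sop_mem.
- by exists 1%N; rewrite expr1; apply: mem_genS; rewrite -(perm_mem pe).
Qed.

Definition expmap n s := [seq y ^+ n | y <- s].

Lemma sop_exp_cat a b n : (0 < n)%N -> sop (a ++ b) -> sop (a ++ expmap n b).
Proof.
move=> n0 ss; apply: (sop_change ss) => [|z|w]; first by rewrite !size_cat size_map.
  rewrite mem_cat => /orP[za|/mapP[y yb ->]].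
    by apply: (sop_mem ss); rewrite mem_cat za.
  case: n n0 => // n _; rewrite exprS; apply: idealMr; apply: (sop_mem ss).
  by rewrite mem_cat yb orbT.
rewrite mem_cat => /orP[wa|wb].
  by exists 1%N; rewrite expr1; apply: mem_genS; rewrite mem_cat wa.
exists n; apply: mem_genS; rewrite mem_cat; apply/orP; right.
exact: (map_f (fun z => z ^+ n)).
Qed.

Lemma sop_exp s n : (0 < n)%N -> sop s -> sop (expmap n s).
Proof. exact: (@sop_exp_cat [::] s n). Qed.

Lemma sop_exp1 y a n : (0 < n)%N -> sop (y :: a) -> sop (y ^+ n :: a).
Proof.
move=> n0 ss; have pe (z : R) : perm_eq (a ++ [:: z]) (z :: a) by rewrite cats1 perm_rcons.
apply: sop_perm (pe _) _; apply: (@sop_exp_cat a [:: y]) => //.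
by apply: sop_perm ss; rewrite perm_sym.
Qed.

(** * The multiplicity *)

Definition hscoef s : {ffun 'I_d.+1 -> int} := hilbert_samuel_coeff K d (gen s).
Definition e0 s : int := hscoef s ord0.
Definition signed (e : {ffun 'I_d.+1 -> int}) (i : nat) : int := (-1) ^+ i * e (inord i).

Lemma hilbert_samuel_value_signed e n : hilbert_samuel_value e n = binom_poly d (signed e) n.
Proof. by apply: eq_bigr => i _; rewrite /signed inord_val. Qed.

Lemma is_hsc_iff s e : sop s -> is_hilbert_samuel_coeffs K (gen s) e <->
  exists N, forall n, (N <= n)%N ->
    (colen (ideal_pow (gen s) n))%:Z = binom_poly d (signed e) n.
Proof.
move=> ss.
have eqv n : colength K (ideal_pow (gen s) n) = ((hilbert_samuel_value e n)%:~R)%:E <->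
    (colen (ideal_pow (gen s) n))%:Z = binom_poly d (signed e) n.
  rewrite colengthE; last exact: sop_fincolen.
  rewrite hilbert_samuel_value_signed; split=> [[]|<-]; last by rewrite pmulrn.
  by rewrite pmulrn => /intr_inj.
split=> [[N _ hN]|[N hN]]; first by exists N => n Nn; apply/eqv; exact: hN.
by exists N => // n /= Nn; apply/eqv; exact: hN.
Qed.

(** The sequence of coefficients chosen by [hilbert_samuel_coeff] is a true
    one because a Hilbert polynomial exists. *)
Lemma hscoefP s : sop s -> exists N, forall n, (N <= n)%N ->
  (colen (ideal_pow (gen s) n))%:Z = binom_poly d (signed (hscoef s)) n.
Proof.
move=> ss; apply/(is_hsc_iff _ ss); apply: (xgetPex [ffun=> 0]).
have [|e] := @hilbert_function_evpoly R s; first by move=> n; exact: sop_fincolen.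
rewrite ss.1 => /evpoly_to_binom_poly[c [N hN]].
exists [ffun i : 'I_d.+1 => (-1) ^+ i * c i]; apply/(is_hsc_iff _ ss).
exists N => n /hN ->; apply: binom_poly_ext => i id.
by rewrite /signed ffunE inordK // mulrA -exprD addnn -mul2n exprM sqrrN !expr1n mul1r.
Qed.

Lemma e0_evpoly s : sop s ->
  evpoly d (e0 s) (fun n => (colen (ideal_pow (gen s) n))%:Z).
Proof.
move=> /hscoefP[N hN]; apply: (@evpoly_eq _ _ (binom_poly d (signed (hscoef s)))).
  by exists N => n /hN.
have -> : e0 s = signed (hscoef s) 0.
  by rewrite /signed expr0 mul1r /e0; congr (hscoef s _); apply: val_inj; rewrite /= inordK.
exact: evpoly_binom_poly.
Qed.

Lemma e0_perm s s' : perm_eq s s' -> e0 s = e0 s'.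
Proof. by move=> pe; rewrite /e0 /hscoef (@gen_eq _ s s') // => z; exact: perm_mem. Qed.

Lemma gen_expmap_pow s N n :
  ideal_pow (gen (expmap N s)) n <:= ideal_pow (gen s) (N * n).
Proof.
elim: n => [|n IH]; first by rewrite muln0.
rewrite mulnS; apply: mul_le => u v hu /IH hv; apply: mem_powD => //.
move: u hu; apply: gen_seq_le => _ /mapP[y ys ->].
by apply: mem_powX; exact: mem_genS.
Qed.

(** Pigeonhole: in a monomial of degree N n + N k in k variables the integral
    parts of the exponents divided by N add up to at least n. *)
Lemma pow_gen_expmap s N n : (0 < N)%N ->
  ideal_pow (gen s) (N * n + N * size s) <:= ideal_pow (gen (expmap N s)) n.
Proof.
move=> N0; elim: s n => [|x s IH] n.
  case: n => [|n]; first exact: le_topI.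
  by rewrite gen_nil !pow_botI //=; lia.
rewrite pow_gen_cons; apply: isum_le => i iM _ /mem_scale[w wJ ->] /=.
have xm : x ^+ N \in gen (expmap N (x :: s)) by apply: mem_genS; exact: mem_head.
have [na|an] := leqP n (i %/ N).
  rewrite (divn_eq i N) exprD; apply: idealMr; apply: idealMr.
  by rewrite mulnC exprM; apply: (pow_decr na); exact: mem_powX.
rewrite -(subnKC (ltnW an)); apply: mem_powD.
  by rewrite {1}(divn_eq i N) exprD mulnC exprM; apply: idealMr; exact: mem_powX.
have hdeg : (N * (n - i %/ N) + N * size s <= N * n + N * size (x :: s) - i)%N.
  have := divn_eq i N; have := ltn_pmod i N0.
  move: (i %/ N)%N (i %% N)%N an => q t an tN -> /=; nia.
have /IH := pow_decr hdeg wJ; apply: pow_mono; apply: gen_mono => z zs.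
by rewrite inE zs orbT.
Qed.

(** The powers of Q_N = (y^N | y in s) are squeezed between those of Q = (s):
    Q^(N n + N d) is contained in Q_N^n, itself contained in Q^(N n). *)
Lemma e0_expmap s N : (0 < N)%N -> sop s -> e0 (expmap N s) = e0 s * (N ^ d)%:Z.
Proof.
move=> N0 ss; have ssN := sop_exp N0 ss; apply/eqP; rewrite eq_le; apply/andP; split.
  apply: (evpoly_le (e0_evpoly ssN) (evpoly_scale (N * d) N0 (e0_evpoly ss))).
  exists 0%N => n _; rewrite lez_nat; apply: colen_mono; first exact: sop_fincolen.
  by rewrite -{1}ss.1; exact: pow_gen_expmap.
apply: (evpoly_le (evpoly_scale 0 N0 (e0_evpoly ss)) (e0_evpoly ssN)).
exists 0%N => n _; rewrite lez_nat addn0; apply: colen_mono; first exact: sop_fincolen.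
exact: gen_expmap_pow.
Qed.

Lemma gen_exp_succ y b n :
  idadd (gen (y ^+ n.+1 :: b)) (gen [:: y ^+ n]) = gen (y ^+ n :: b).
Proof.
apply: ideal_ext; last first.
  apply: gen_seq_le => z; rewrite inE => /orP[/eqP ->|zb].
    by apply: idaddr; apply: mem_genS; exact: mem_head.
  by apply: idaddl; apply: mem_genS; rewrite inE zb orbT.
apply: idadd_le; apply: gen_seq_le => z; rewrite inE; last first.
  by move/eqP => ->; apply: mem_genS; exact: mem_head.
move=> /orP[/eqP ->|zb]; last by apply: mem_genS; rewrite inE zb orbT.
by rewrite exprS; apply: idealMl; apply: mem_genS; exact: mem_head.
Qed.

Lemma colen_exp_step y b n : fincolen (gen (y ^+ n.+1 :: b)) ->
  colen (gen (y ^+ n.+1 :: b)) =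
  (colen (colon (gen (y ^+ n.+1 :: b)) (y ^+ n)) + colen (gen (y ^+ n :: b)))%N.
Proof. by move=> fI; rewrite (colen_colon (y ^+ n) fI) -gen1 gen_exp_succ. Qed.

Lemma colon_exp_succ y b n :
  colon (gen (y ^+ n.+1 :: b)) (y ^+ n) = idadd (colon (gen b) (y ^+ n)) (gen [:: y]).
Proof.
apply: ideal_ext.
  move=> r /mem_colon/mem_gen_cons[t ht]; rewrite -(subrK (t * y) r).
  apply: idadd_mem; last by apply/mem_gen1; exists t.
  by apply/mem_colon; rewrite mulrBl -mulrA -exprS.
apply: idadd_le => r.
  move/mem_colon => h; apply/mem_colon; apply: gen_mono h => z zb.
  by rewrite inE zb orbT.
move=> /mem_gen1[t ->]; apply/mem_colon; rewrite -mulrA -exprS; apply: idealMl.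
by apply: mem_genS; exact: mem_head.
Qed.

(** Each of the n steps from (y^n, b) to the unit ideal is a quotient of
    R/(y, b). *)
Lemma colen_subadd y b n : (0 < n)%N -> sop (y :: b) ->
  (colen (gen (y ^+ n :: b)) <= n * colen (gen (y :: b)))%N.
Proof.
move=> n0 ss; case: n n0 => // n _; elim: n => [|n IH]; first by rewrite expr1 mul1n.
rewrite colen_exp_step; last by apply: sop_fincolen1; exact: sop_exp1.
rewrite mulSn; apply: leq_add => //; apply: colen_mono; first exact: sop_fincolen1.
apply: gen_seq_le => z; rewrite colon_exp_succ inE => /orP[/eqP ->|zb].
  by apply: idaddr; apply: mem_genS; exact: mem_head.
by apply: idaddl; apply: colon_ge; exact: mem_genS.
Qed.

(** * Buchsbaum rings *)

Variable p : nat.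
Hypotheses (hbuch : buchsbaum K d m) (hchar : p \in [pchar R]).

Lemma frobenius_add x y e : (x + y) ^+ (p ^ e)%N = x ^+ (p ^ e)%N + y ^+ (p ^ e)%N.
Proof.
by apply: exprDn_pchar; rewrite pnatX pnatE ?(pcharf_prime hchar) // hchar.
Qed.

Lemma pchar_gt1 : (1 < p)%N. Proof. exact: prime_gt1 (pcharf_prime hchar). Qed.

Lemma buchsbaum_const s0 : sop s0 ->
  exists c : int, forall s, sop s -> (colen (gen s))%:Z = e0 s + c.
Proof.
move=> ss0; case: hbuch => c hc.
have val s : sop s -> c = (((colen (gen s))%:Z - e0 s)%:~R)%:E.
  move=> ss; have [t st es] := sop_tuple ss; rewrite -(hc t st) es.
  rewrite colengthE; last exact: sop_fincolen1.
  by rewrite rmorphB /= pmulrn EFinB.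
exists ((colen (gen s0))%:Z - e0 s0) => s ss.
have := val s ss; rewrite (val s0 ss0) => -[/intr_inj ->].
by rewrite addrC subrK.
Qed.

Variable c : int.
Hypothesis hc : forall s, sop s -> (colen (gen s))%:Z = e0 s + c.

(** The bound on colengths gives one on e_0 up to an error bounded by a multiple
    of c; replacing all parameters by their N-th powers multiplies both sides
    by N^d but not the error, which disappears as N grows. *)
Lemma e0_subadd y b n : (0 < n)%N -> sop (y :: b) ->
  e0 (y ^+ n :: b) <= n%:Z * e0 (y :: b).
Proof.
move=> n0 ss; rewrite leNgt; apply/negP => hlt.
have ssn := sop_exp1 n0 ss.
have key N : (0 < N)%N ->
    e0 (y ^+ n :: b) * (N ^ d)%:Z + c <= n%:Z * (e0 (y :: b) * (N ^ d)%:Z + c).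
  move=> N0; have := colen_subadd n0 (sop_exp N0 ss).
  rewrite -!e0_expmap // -!hc; [|exact: sop_exp..].
  by rewrite -lez_nat PoszM /= -!exprM mulnC.
have d0 : (0 < d)%N by rewrite -ss.1.
(* Large enough for N^d to exceed the error term (n - 1) c. *)
pose N := (absz ((n%:Z - 1) * c)%R + 1)%N.
have hN : (N <= N ^ d)%N by rewrite -{1}(expn1 N) leq_pexp2l // /N addn1.
have := key N; move: hN; move: (N ^ d)%N => M hN keyN.
have N0 : (0 < N)%N by rewrite /N addn1.
have {keyN} := keyN N0.
move: hlt; set v := e0 _; set u := e0 _ => hlt h.
have h1 : (u - n%:Z * v) * M%:Z <= (n%:Z - 1) * c.
  rewrite -subr_ge0; move: h; rewrite -subr_ge0.
  by have -> : n%:Z * (v * M%:Z + c) - (u * M%:Z + c) =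
    (n%:Z - 1) * c - (u - n%:Z * v) * M%:Z by ring.
have h2 : M%:Z <= (u - n%:Z * v) * M%:Z by rewrite ler_peMl //; lia.
by move: hN; rewrite /N; lia.
Qed.

Lemma e0_subadd_seq b a n : (0 < n)%N -> sop (b ++ a) ->
  e0 (expmap n b ++ a) <= (n ^ size b)%:Z * e0 (b ++ a).
Proof.
move=> n0; elim: b a => [|y b IH] a ss; first by rewrite mul1r.
have pe (z : R) (t : seq R) : perm_eq (z :: t ++ a) (t ++ z :: a).
  by rewrite -cat_rcons -cat_cons perm_cat2r -perm_rcons perm_rcons perm_sym perm_rcons.
have ss' : sop (b ++ y :: a) by apply: sop_perm ss; exact: pe.
have ssn : sop (y ^+ n :: (b ++ a)) by exact: sop_exp1.
rewrite /= (e0_perm (pe _ _)) -/(expmap n b).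
have := IH (y ^+ n :: a) (sop_perm (pe _ _) ssn).
rewrite -(e0_perm (pe (y ^+ n) b)).
have := e0_subadd n0 ss; rewrite /= expnSr PoszM -mulrA => h1 h2.
by apply: le_trans h2 _; rewrite ler_wpM2l.
Qed.

(** By homogeneity n^d e_0(y, a) is the multiplicity of all n-th powers, and by
    subadditivity in the d - 1 entries of a it is at most n^(d-1) e_0(y^n, a);
    this is the inequality opposite to [e0_subadd]. *)
Lemma e0_linear y a n : (0 < n)%N -> sop (y :: a) ->
  e0 (y ^+ n :: a) = n%:Z * e0 (y :: a).
Proof.
move=> n0 ss; apply/eqP; rewrite eq_le e0_subadd //=.
have pe (z : R) (t : seq R) : perm_eq (z :: t) (t ++ [:: z]).
  by rewrite cats1 perm_sym perm_rcons.
have := @e0_subadd_seq a [:: y ^+ n] n n0 (sop_perm (pe _ _) (sop_exp1 n0 ss)).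
rewrite -!(e0_perm (pe _ _)) -[_ :: _]/(expmap n (y :: a)) e0_expmap // -ss.1 /= expnS.
rewrite PoszM mulrC [_%:Z * _%:Z]mulrC -mulrA ler_pM2l //.
by rewrite ltz_nat expn_gt0 n0.
Qed.

(** The colength of (y^k, a) being affine in k, its increments, which are the
    colengths of (a : y^k) + (y), are all equal for k > 0; as these ideals
    increase with k they coincide.  Hence (a : y^k) lies in (a : y) + (y^j) for
    all j, and Krull's theorem applies. *)
Lemma colon_sat y a n : (0 < n)%N -> sop (y :: a) ->
  colon (gen a) (y ^+ n) <:= colon (gen a) y.
Proof.
move=> n0 ss; have ym : y \in m by apply: (sop_mem ss); exact: mem_head.
pose S k := idadd (colon (gen a) (y ^+ k)) (gen [:: y]).
have cS k : (0 < k)%N -> (colen (S k))%:Z = e0 (y :: a).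
  move=> k0; have := @colen_exp_step y a k (sop_fincolen1 (sop_exp1 (ltn0Sn k) ss)).
  rewrite colon_exp_succ -/(S k) => h.
  have := hc (sop_exp1 (ltn0Sn k) ss); rewrite h PoszD hc; last exact: sop_exp1.
  by rewrite !e0_linear // => h2; have : (k.+1)%:Z = k%:Z + 1 by [lia]; nia.
have Sle k : (0 < k)%N -> S k <:= S 1%N.
  move=> k0; have fS : fincolen (S 1%N).
    rewrite /S -colon_exp_succ; apply: fincolen_sub (@colon_ge _ _ _) _.
    by apply: sop_fincolen1; exact: sop_exp1.
  suff -> : S 1%N = S k by [].
  apply: colen_eq fS _ _; last by apply/eqP; rewrite -eqz_nat !cS.
  apply: idadd_mono => //; rewrite expr1 -[in X in _ <:= X](prednK k0) exprS colonM.
  exact: colon_ge.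
(* Write r = u + t y with u in (a : y); then t lies in (a : y^(k+1)). *)
have key j : forall k, (0 < k)%N ->
    colon (gen a) (y ^+ k) <:= idadd (colon (gen a) y) (gen [:: y ^+ j]).
  elim: j => [|j IH] k k0 r hr.
    apply: idaddr; rewrite expr0; apply/mem_gen1; exists r; by rewrite mulr1.
  have /mem_add[u] : r \in S 1%N by apply: (Sle k k0); exact: idaddl.
  rewrite expr1 => /mem_colon uy /mem_gen1[t et].
  have : t \in colon (gen a) (y ^+ k.+1).
    apply/mem_colon; rewrite exprS mulrA -et mulrBl; apply: idealB.
      exact/mem_colon.
    by rewrite -(prednK k0) exprS mulrA; exact: idealMr.
  move=> /(IH _ (ltn0Sn k))/mem_add[v /mem_colon vy /mem_gen1[w ew]].
  have -> : r = (u + v * y) + w * y ^+ j.+1.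
    by rewrite -[LHS](subrK u) et -[t](subrK v) ew exprSr; ring.
  apply: idadd_mem; last by apply/mem_gen1; exists w.
  by apply: idealD; apply/mem_colon => //; exact: idealMr.
move=> r hr; apply: (krull_principal hnoeth hloc ym) => N; exact: key hr.
Qed.

(** In characteristic p the parameters y and y + z have the same q-th power
    modulo a when z^q is in a. *)
Lemma colon_swap y z a e : sop (y :: a) -> sop ((y + z) :: a) ->
  z ^+ (p ^ e)%N \in gen a -> colon (gen a) y <:= colon (gen a) (y + z).
Proof.
move=> ss ss' za r /mem_colon ry.
have q0 : (0 < p ^ e)%N by rewrite expn_gt0 (ltnW pchar_gt1).
apply: (colon_sat q0 ss'); apply/mem_colon; rewrite frobenius_add mulrDr.
by apply: idealD; [rewrite -(prednK q0) exprS mulrA; exact: idealMr|exact: idealMl].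
Qed.


Lemma perm_mid (x : R) pre post : perm_eq (pre ++ x :: post) (x :: pre ++ post).
Proof. by rewrite -cat_rcons -cat_cons perm_cat2r perm_rcons. Qed.

Lemma sop_mid_exp x pre post N : (0 < N)%N -> sop (pre ++ x :: post) ->
  sop (x :: pre ++ expmap N post).
Proof.
move=> N0 ss; apply: (@sop_exp_cat (x :: pre) post) => //.
by apply: sop_perm ss; exact: perm_mid.
Qed.

(** Add high powers of the parameters in post to pre, so as to be left with one
    parameter and [colon_sat], then let the exponents tend to infinity. *)
Lemma colon_sq s pre x post r : sop s -> s = pre ++ x :: post ->
  r * x * x \in gen pre -> r * x \in gen pre.
Proof.
move=> ss es rxx; rewrite {}es in ss.
apply: (@krull_seq_cofinal _ hnoeth _ hloc post succn) => [y yp|//|N].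
  by apply: (sop_mem ss); rewrite mem_cat inE yp !orbT.
rewrite -gen_cat; apply/mem_colon.
apply: (@colon_sat x (pre ++ expmap N.+1 post) 2) => //; first exact: sop_mid_exp.
apply/mem_colon; rewrite expr2 mulrA; apply: gen_mono rxx => z zp.
by rewrite mem_cat zp.
Qed.

(** Suppose that r x y lies in (pre).  Add to pre the q-th powers of all the
    other parameters, including y: the element r y, killed by x, is also killed
    by x + y, hence by y.  Letting q grow, r y^2 lies in (pre), and [colon_sq]
    finishes. *)
Theorem buchsbaum_dseq s : sop s -> dseq s.
Proof.
move=> ss pre x post y r es; rewrite inE => /orP[/eqP ->|yp] rxy.
  exact: colon_sq es rxy.
case/splitPr: yp es => p1 p2 es.
have ssy : sop (pre ++ y :: (x :: p1 ++ p2)).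
  apply: sop_perm ss; rewrite es perm_cat2l -[x :: p1 ++ y :: p2]cat_cons.
  exact: perm_mid.
apply: (colon_sq ssy (erefl _)).
apply: (@krull_seq_cofinal _ hnoeth _ hloc (p1 ++ y :: p2) (fun N => p ^ N)%N)
  => [z zp|N|N].
- by apply: (sop_mem ss); rewrite es mem_cat inE zp !orbT.
- by apply: ltnW; exact: ltn_expl pchar_gt1.
have q0 : (0 < p ^ N)%N by rewrite expn_gt0 (ltnW pchar_gt1).
rewrite -gen_cat -/(expmap (p ^ N) (p1 ++ y :: p2)).
set a := pre ++ expmap _ _.
have sx : sop (x :: a) by apply: sop_mid_exp => //; rewrite -es.
have ya : y ^+ (p ^ N)%N \in gen a.
  apply: mem_genS; rewrite mem_cat; apply/orP; right.
  by apply: (map_f (fun z => z ^+ _)); rewrite mem_cat mem_head orbT.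
have sxy : sop ((x + y) :: a).
  apply: (sop_change sx) => [//|z|w].
    rewrite inE => /orP[/eqP ->|za]; last by apply: (sop_mem sx); rewrite inE za orbT.
    apply: idealD; first by apply: (sop_mem sx); exact: mem_head.
    by apply: (sop_mem ss); rewrite es mem_cat inE mem_cat mem_head !orbT.
  rewrite inE => /orP[/eqP ->|wa]; last first.
    by exists 1%N; rewrite expr1; apply: mem_genS; rewrite inE wa orbT.
  exists (p ^ N)%N; have -> : x ^+ (p ^ N)%N = (x + y) ^+ (p ^ N)%N - y ^+ (p ^ N)%N.
    by rewrite frobenius_add addrK.
  apply: idealB.
    by rewrite -(prednK q0) exprS; apply: idealMr; apply: mem_genS; exact: mem_head.
  by apply: gen_mono ya => z za; rewrite inE za orbT.
have pa : gen pre <:= gen a by apply: gen_mono => z zp; rewrite mem_cat zp.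
have ryx : r * y * x \in gen a by apply: pa; rewrite mulrAC.
have -> : r * y * y = r * y * (x + y) - r * y * x by ring.
apply: idealB => //; apply/mem_colon; apply: (colon_swap sx sxy ya).
exact/mem_colon.
Qed.

(** * Hilbert coefficients of parameter ideals *)

Lemma sop_hilbert s n : sop s -> (0 < n)%N ->
  (colen (ideal_pow (gen s) n))%:Z = binom_poly d (hcoef s d) n.
Proof.
move=> ss n0; have := @dseq_hilbert_function _ _ (buchsbaum_dseq ss) _ n n0.
by rewrite ss.1; apply=> k; exact: sop_fincolen.
Qed.

Lemma hcoef_signed s i : sop s -> (i <= d)%N -> signed (hscoef s) i = hcoef s d i.
Proof.
move=> ss; apply: binom_poly_inj; have [N hN] := hscoefP ss.
exists N.+1 => n Nn; rewrite -hN ?(ltnW Nn) // sop_hilbert //.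
exact: leq_trans Nn.
Qed.

Lemma e0_hcoef s : sop s -> e0 s = hcoef s d 0.
Proof.
move=> ss; rewrite -hcoef_signed // /signed expr0 mul1r /e0.
by congr (hscoef s _); apply: val_inj; rewrite /= inordK.
Qed.

(** The leading coefficient of the Hilbert function of a d-sequence is
    [ell 0 - ell 1], so the last gap is the Buchsbaum constant. *)
Lemma ell1 s : sop s -> (0 < d)%N -> ell s 1 = c.
Proof.
move=> ss d0; have := hc ss; rewrite (e0_hcoef ss) /hcoef d0 /=.
by rewrite -[(colen (gen s))%:Z]/(ell s 0) => h; lia.
Qed.

(** A difference of two numbers in the interval from 0 to c. *)
Lemma hcoef_bound s i : sop s -> (0 < i)%N -> (i <= d)%N -> `|hcoef s d i| <= c.
Proof.
move=> ss i0 id; have d0 : (0 < d)%N by exact: leq_trans id.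
have hb k : (0 < k)%N -> (k <= d)%N -> 0 <= ell s k <= c.
  move=> k0 kd; rewrite ell_ge0 -(ell1 ss d0) /=; apply: ell_le1 => //; last by rewrite ss.1.
    exact: buchsbaum_dseq.
  by move=> n; exact: sop_fincolen.
have := hb i i0 id; rewrite /hcoef; case: ifP => [id'|_]; last by lia.
by have := hb i.+1 (ltn0Sn i) id'; lia.
Qed.

End SystemsOfParameters.

(** * Frobenius powers *)

Section Frobenius.
Variables (R : comNzRingType) (p : nat).
Hypothesis hchar : p \in [pchar R].
Implicit Types (I J : ideal R) (s : seq R).

(** In characteristic p the elements whose q-th power lies in J form an ideal,
    so inclusions of Frobenius powers can be checked on generators. *)
Lemma frobenius_cond J e : @ideal_cond R [set z | z ^+ (p ^ e)%N \in J].
Proof.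
have q0 : (0 < p ^ e)%N by rewrite expn_gt0 (ltnW (pchar_gt1 hchar)).
split=> /= [|x y xJ yJ|r x xJ].
- by rewrite expr0n eqn0Ngt q0; exact: ideal0.
- by rewrite (frobenius_add hchar); exact: idealD.
- by rewrite exprMn; exact: idealMl.
Qed.

Lemma mem_frobenius_pow q I x : x \in I -> x ^+ q \in frobenius_pow q I.
Proof. by move=> xI; apply: mem_gen; exists x. Qed.

Lemma frobenius_pow_gen e s :
  frobenius_pow (p ^ e)%N (gen s) = gen (expmap (p ^ e)%N s).
Proof.
apply: ideal_ext.
  apply: gen_le => _ [x /= xs <-]; apply: (gen_ind (frobenius_cond _ e) _ xs) => y ys.
  by apply: mem_genS; exact: (map_f (fun z => z ^+ _)).
apply: gen_seq_le => _ /mapP[y ys ->].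
by apply: mem_frobenius_pow; exact: mem_genS.
Qed.

Lemma frobenius_pow_mul e I J : frobenius_pow (p ^ e)%N (ideal_mul I J) =
  ideal_mul (frobenius_pow (p ^ e)%N I) (frobenius_pow (p ^ e)%N J).
Proof.
set q := (p ^ e)%N; apply: ideal_ext.
  apply: gen_le => _ [x /= xs <-].
  apply: (gen_ind (frobenius_cond _ e) _ xs) => _ [a aI [b bJ <-]] /=.
  by rewrite exprMn; apply: mem_mul; exact: mem_frobenius_pow.
apply: mul_le => u v uI vJ; apply/mem_colon; move: u uI.
apply: gen_le => _ [a /= aI <-]; apply/mem_colon; rewrite mulrC; apply/mem_colon.
move: v vJ; apply: gen_le => _ [b /= bJ <-]; apply/mem_colon.
by rewrite -exprMn mulrC; apply: mem_frobenius_pow; exact: mem_mul.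
Qed.

Lemma frobenius_pow_pow e I k : frobenius_pow (p ^ e)%N (ideal_pow I k) =
  ideal_pow (frobenius_pow (p ^ e)%N I) k.
Proof.
elim: k => [|k IH]; last by rewrite !powS frobenius_pow_mul IH.
apply: eq_topI; rewrite -(expr1n _ (p ^ e)%N).
by apply: mem_frobenius_pow; exact: mem_topI.
Qed.

End Frobenius.

Lemma cvg_bound_harmonic (K : realType) (u : nat -> K) (l C : K) :
  (forall n, `|u n - l| <= C * n.+1%:R^-1) -> u @ \oo --> l.
Proof.
move=> hu; have h0 : (fun n : nat => C * n.+1%:R^-1) @ \oo --> (0 : K).
  by rewrite -[X in _ --> X](mulr0 C); apply: cvgMr; exact: cvg_harmonic.
apply: (@squeeze_cvgr _ _ _ _ (fun n : nat => l - C * n.+1%:R^-1)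
    (fun n : nat => l + C * n.+1%:R^-1)).
- near=> n; have := hu n; rewrite ler_distl => /andP[h1 h2]; apply/andP; split => //.
- by rewrite -[X in _ --> X]subr0; apply: cvgB => //; exact: cvg_cst.
- by rewrite -[X in _ --> X]addr0; apply: cvgD => //; exact: cvg_cst.
Unshelve. all: by end_near.
Qed.

Unset Implicit Arguments.

Theorem theorem1p3 (K : realType) (R : comNzRingType) (m : ideal R)
    (d p : nat) (x : d.-tuple R)
    (hnoeth : noetherian R) (hloc : local_ring m)
    (hdim : krull_dim K R = (d%:R)%:E)
    (hbuch : buchsbaum K d m)
    (hchar : p \in [pchar R])
    (hx : system_of_parameters m x) :
  let I := ideal_gen [set y | y \in x] in
  (forall i : 'I_d.+1, (0 < i)%N ->
    (fun e : nat =>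
       (hilbert_samuel_coeff K d (frobenius_pow (p ^ e)%N I) i)%:~R
         / (p ^ e)%N%:R ^+ d : K) @ \oo --> (0 : K)) /\
  (forall k : nat, (0 < k)%N ->
    hilbert_kunz K d p (ideal_pow I k) =
      ((hilbert_samuel_coeff K d I ord0)%:~R * ('C(k + d - 1, d))%N%:R)%:E).
Proof.
move=> I; have -> : I = gen (tval x) by [].
have ss : sop m d (tval x).
  by split; [exact: size_tuple|apply/(m_primary_radm hnoeth hloc)].
have [c hc] := buchsbaum_const hnoeth hloc hbuch ss.
have q0 e : (0 < p ^ e)%N by rewrite expn_gt0 (ltnW (pchar_gt1 hchar)).
have ssq e : sop m d (expmap (p ^ e)%N x) by exact: sop_exp.
have qd e : (0 < d)%N -> e.+1%:R <= ((p ^ e)%N%:R ^+ d : K).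
  move=> d0; rewrite -natrX ler_nat.
  apply: (leq_trans (ltn_expl e (pchar_gt1 hchar))).
  by rewrite -[X in (X <= _)%N]expn1 leq_pexp2l.
have qd0 e : 0 < ((p ^ e)%N%:R ^+ d : K) by rewrite exprn_gt0 // ltr0n.
have qinv e : (0 < d)%N -> ((p ^ e)%N%:R ^+ d : K)^-1 <= e.+1%:R^-1.
  by move=> d0; rewrite lef_pV2 ?posrE ?qd ?ltr0n.
split=> [i i0|k k0].
  apply: (@cvg_bound_harmonic _ _ _ c%:~R) => e.
  have d0 : (0 < d)%N by apply: leq_trans i0 _; rewrite -ltnS.
  rewrite subr0 normrM normfV (gtr0_norm (qd0 e)).
  apply: ler_pM => //; last exact: qinv.
  rewrite (frobenius_pow_gen hchar) -intr_norm ler_int.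
  have id : (i <= d)%N by rewrite -ltnS.
  have := hcoef_bound hnoeth hloc hchar hc (ssq e) i0 id.
  rewrite -(hcoef_signed hnoeth hloc hchar hc (ssq e)) //.
  by rewrite /signed normrM normrX normrN1 expr1n mul1r inord_val.
pose C k := 'C(k + d - 1, d).
rewrite /hilbert_kunz.
pose w e : K := (binom_poly d (hcoef (expmap (p ^ e)%N x) d) k)%:~R *
  ((p ^ e)%N%:R ^+ d)^-1.
rewrite (_ : (fun e : nat => _) = (fun e => (w e)%:E)); last first.
  apply/funext => e; rewrite (frobenius_pow_pow hchar) (frobenius_pow_gen hchar).
  rewrite colengthE; last exact: (sop_fincolen hnoeth hloc).
  by rewrite -EFinM /w -(sop_hilbert hnoeth hloc hchar hc (ssq e) k0) -pmulrn.
apply/cvg_lim => //; apply/fine_cvgP; split; first by near=> e.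
pose M : int := \sum_(i < d) c * ('C(k + d - i.+1 - 1, d - i.+1))%:Z.
apply: (@cvg_bound_harmonic _ _ _ M%:~R) => e /=.
have we : w e - (hilbert_samuel_coeff K d (gen x) ord0)%:~R * (C k)%:R =
  (\sum_(i < d) hcoef (expmap (p ^ e)%N x) d i.+1 *
     ('C(k + d - i.+1 - 1, d - i.+1))%:Z)%:~R
    / (p ^ e)%N%:R ^+ d.
  rewrite /w /binom_poly big_ord_recl /= -(e0_hcoef hnoeth hloc hchar hc (ssq e)).
  rewrite (e0_expmap K hnoeth hloc (q0 e) ss) !subn0 rmorphD /= mulrDl addrAC.
  have -> : (e0 K d x * ((p ^ e) ^ d)%N%:Z * 'C(k + d - 1, d)%:Z)%:~R
      / (p ^ e)%N%:R ^+ d =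
      (e0 K d x)%:~R * (C k)%:R :> K.
    by rewrite !rmorphM /= -!pmulrn (natrX _ (p ^ e)%N) mulrAC mulfK ?lt0r_neq0.
  by rewrite subrr add0r.
rewrite we normrM normfV (gtr0_norm (qd0 e)).
have [d0|d0] := posnP d.
  have no_i (i : 'I_d) : False by have := ltn_ord i; rewrite [X in (_ < X)%N]d0.
  by rewrite /M !big1 ?normr0 ?mul0r // => i; case: (no_i i).
apply: ler_pM => //; last exact: qinv.
rewrite -intr_norm ler_int; apply: le_trans (ler_norm_sum _ _ _) _.
apply: ler_sum => i _; rewrite normrM; apply: ler_pM => //.
exact: (hcoef_bound hnoeth hloc hchar hc (ssq e) (ltn0Sn i) (ltn_ord i)).
Unshelve. all: by end_near.
Qed.
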